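(* Let $\mathbf E$ be a conditionally normed space and let $\mathbf j:\mathbf E\to\mathbf E^{**}$ be the natural conditional embedding, $\mathbf j(\mathbf x)(\mathbf x^* )=\mathbf x^*(\mathbf x)$. Then $\mathbf j(\mathbf B_{\mathbf E})$ is conditionally $\sigma(\mathbf E^{**},\mathbf E^* )$-dense in $\mathbf B_{\mathbf E^{**}}$, i.e. $\mathbf j(\mathbf B_{\mathbf E})\sqsubset\mathbf B_{\mathbf E^{**}}$ and the conditional closure of $\mathbf j(\mathbf B_{\mathbf E})$ in $\mathbf B_{\mathbf E^{**}}$ with respect to $\sigma(\mathbf E^{**},\mathbf E^* )$ is $\mathbf B_{\mathbf E^{**}}$.
   Context: Throughout, $\mathcal A$ is a fixed complete Boolean algebra with operations $\vee,\wedge,{}^c$ and bounds $0,1$; $p(a)$ is the set of families $\{a_i\}_{i\in I}$ of pairwise disjoint elements of $\mathcal A$ (some possibly $0$) with supremum $a$. Conditional sets. A conditional set $\mathbf E$ of a nonempty set $E$ is a collection of objects $x|a$ ($x\in E$, $a\in\mathcal A$) such that: $x|a=y|b$ implies $a=b$; if $a\le b$ and $x|b=y|b$ then $x|a=y|a$; for all $\{a_i\}\in p(1)$ and $\{x_i\}\subset E$ there is a unique $x\in E$, denoted $\sum x_i|a_i$, with $x|a_i=x_i|a_i$ for all $i$. The conditional elements of $\mathbf E$ are the objects $\mathbf x=x|1$, $x\in E$; write $\mathbf x\in\mathbf E$. A nonempty $F\subset E$ is stable if it contains all $\sum x_i|a_i$ with $\{a_i\}\in p(1)$, $\{x_i\}\subset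 F$; the stable hull of a nonempty set is the smallest stable set containing it. For $F$ stable and $a\in\mathcal A$, $\mathbf F|a=\{x|b: x\in F,\ b\le a\}$ is called a conditional subset of $\mathbf E$ on $a$ (and $\mathbf F=\mathbf F|1$); its conditional elements are the $x|a$ with $x\in F$. We write $\mathbf F\sqsubset\mathbf E$ for ''$\mathbf F$ is a conditional subset of $\mathbf E$ on some $a$''; between conditional subsets, $\sqsubset$ is inclusion of collections. $\mathbf E|0$ is the null conditional subset. $[\mathbf x\in\mathbf E:\phi(\mathbf x)]$ is the conditional subset on $1$ generated by the stable hull of the (nonempty) set $\{x:\phi(\mathbf x)\}$. $\sqcap$ is intersection, $\sqcup$ is the smallest conditional subset containing the given ones, and $\mathbf F^{\sqsubset}$ is the largest conditional subset $\mathbf G$ with $\mathbf F\sqcap\mathbf G=\mathbf E|0$. Functions. A function $f:E\to F$ is stable if $f(\sum x_i|a_i)=\sum f(x_i)|a_i$; it then defines a conditional function $\mathbf f:\mathbf E\to\mathbf F$, $\mathbf f(\mathbf x)=f(x)|1$; the image of $\mathbf A|a$ is $\{f(x)|b:x\in A,b\le a\}$. It is conditionally injective if ($x|a\ne x'|a$ for all $a\neq0$) implies ($f(x)|a\ne f(x')|a$ for all $a\ne0$), conditionally surjective if $f$ is surjective, conditionally bijective if both. $\mathbf E\Join\mathbf F$ is the conditional set of $E\times F$ with $(x,y)|a=(x|a,y|a)$. Numbers. $\mathbf N$ (resp. $\mathbf Q$) is the conditional set whose generating set $N$ (resp. $Q$) consists of formal sums $\sum n_i|a_i$ with $\{a_i\}\in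 p(1)$ and $n_i\in\mathbb N=\{1,2,\dots\}$ (resp. $n_i\in\mathbb Q$), where $(\sum n_i|a_i)|a=(\sum m_j|b_j)|a$ iff $n_i=m_j$ whenever $a_i\wedge b_j\wedge a\ne0$; operations and order are componentwise ($\sum n_i|a_i\le\sum m_j|b_j$ iff $n_i\le m_j$ whenever $a_i\wedge b_j\ne0$; similarly $<$). $\mathbf R$ denotes the conditional real numbers: the conditionally totally ordered, conditionally Dedekind complete field containing $\mathbf Q$ (extending its operations and order). That is, $\mathbf R$ is a conditional set of a set $R$ with stable commutative ring operations such that every $r$ with $r|a\neq 0|a$ for all $a\ne0$ is invertible, and with a stable partial order compatible with the ring operations such that for all $r,s$ there is $a$ with $r|a\le s|a$ and $s|a^c\le r|a^c$ (where $r|a\le s|a$ means $r|a+s|a^c\le s$), and every conditional subset on $1$ with an upper bound has a supremum. It is unique up to isomorphism; for the measure algebra of a $\sigma$-finite measure space $R=L^0$. $\mathbf r<\mathbf s$ means $\mathbf r\le\mathbf s$ and $r|a\ne s|a$ for all $a\neq0$. $\mathbf R^+=[\mathbf r\ge\mathbf 0]$, $\mathbf R^{++}=[\mathbf r>\mathbf 0]$, and $|\mathbf r|$ is the supremum of $\mathbf r,-\mathbf r$. A conditional set is conditionally finite if it is in conditional bijection with $[\mathbf k\in\mathbf N:\mathbf 1\le\mathbf k\le\mathbf n]$ for some $\mathbf n\in\mathbf N$. Normed spaces. A conditional vector space is a conditional set $\mathbf E$ with stable operations $+:\mathbf E\Join\mathbf E\to\mathbf E$, $\cdot:\mathbf R\Join\mathbf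 E\to\mathbf E$ making $E$ a unital $R$-module. Every conditional vector space is assumed to have support $1$: $\bigvee\{a:\exists x\in E,\ x|b\neq0|b\ \forall\,0\ne b\le a\}=1$. A conditionally normed space is a conditional vector space with a conditional function $\|\cdot\|:\mathbf E\to\mathbf R^+$ with $\|\mathbf r\mathbf x\|=|\mathbf r|\|\mathbf x\|$, $\|\mathbf x+\mathbf y\|\le\|\mathbf x\|+\|\mathbf y\|$, and $\|\mathbf x\|=\mathbf 0$ only if $\mathbf x=\mathbf 0$. $\mathbf B_{\mathbf E}=[\mathbf x\in\mathbf E:\|\mathbf x\|\le\mathbf 1]$. A conditionally linear function $\mathbf f:\mathbf E\to\mathbf R$ is a conditional function with $f$ $R$-linear; it is conditionally continuous iff there is $\mathbf r\in\mathbf R$ with $|\mathbf f(\mathbf x)|\le\mathbf r\|\mathbf x\|$ for all $\mathbf x\in\mathbf E$. $\mathbf E^*$ is the conditional vector space of conditionally linear, conditionally continuous $\mathbf f:\mathbf E\to\mathbf R$ (with $f|a=g|a$ iff $f(x)|a=g(x)|a$ for all $x$), normed by $\|\mathbf f\|=\sup[|\mathbf f(\mathbf x)|:\mathbf x\in\mathbf B_{\mathbf E}]$; $\mathbf E^{**}=(\mathbf E^* )^*$. Topology $\sigma(\mathbf E^{**},\mathbf E^* )$: a conditional subset $\mathbf O$ of $\mathbf E^{**}$ on $a$ is conditionally open iff for every $z\in E^{**}$ with $z|a\in\mathbf O$ there are a conditionally finite $\mathbf G\sqsubset\mathbf E^*$ on $1$ and $\mathbf r\in\mathbf R^{++}$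 with $(\mathbf z+\mathbf U_{\mathbf G,\mathbf r})|a\sqsubset\mathbf O$, where $\mathbf U_{\mathbf G,\mathbf r}=[\mathbf y\in\mathbf E^{**}:\sup_{\mathbf x^*\in\mathbf G}|\mathbf y(\mathbf x^* )|\le\mathbf r]$. A conditional subset is conditionally closed if its conditional complement ${}^{\sqsubset}$ is conditionally open; the conditional closure is the $\sqcap$ of all conditionally closed conditional subsets containing it. *)

(* Defs.v *)
Set Warnings "-notation-overridden,-ambiguous-paths".
From HB Require Import structures.
From mathcomp Require Import all_boot all_order all_algebra.
From mathcomp Require Import ring mathcomp_extra boolp classical_sets.

Set Implicit Arguments.
Unset Strict Implicit.
Unset Printing Implicit Defensive.

Import Order.Theory GRing.Theory.

Local Open Scope classical_set_scope.
Local Open Scope order_scope.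

HB.mixin Record isCompleteLattice d L of Order.POrder d L := {
  supremums_exist : forall S : set L, supremums S !=set0
}.

#[short(type="completeBoolType")]
HB.structure Definition CompleteBool d :=
  { L of Order.CTBDistrLattice d L & isCompleteLattice d L }.

Section Families.
Context {d : Order.disp_t} {A : completeBoolType d}.

(* [a] belongs to p(b); some of the [a i] may be [\bot] *)
Definition cpart (I : Type) (a : I -> A) (b : A) : Prop :=
  (forall i j, i <> j -> a i `&` a j = \bot) /\ supremums (range a) b.

End Families.

(* [obj] is a type containing the objects x|a and [cond x a] is x|a itself, so
   that equality of conditional objects is Leibniz equality in [obj].  Elements
   of [obj] that are not of the form x|a play no role. *)
HB.mixin Record isCondSet d (A : completeBoolType d) E := {
  obj : Type;
  cond : E -> A -> obj;
  cset_inhabited : inhabited E;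
  cond_inj : forall x y a b, cond x a = cond y b -> a = b;
  cond_mono : forall x y a b, a <= b -> cond x b = cond y b ->
    cond x a = cond y a;
  cond_glue : forall (I : Type) (a : I -> A) (x : I -> E), cpart a \top ->
    exists! z, forall i, cond z (a i) = cond (x i) (a i)
}.

#[short(type="condSetType")]
HB.structure Definition CondSet d (A : completeBoolType d) :=
  { E of isCondSet d A E }.

Arguments obj {d A} s.
Arguments cond {d A s} x a.
Arguments cset_inhabited {d A} s.
Arguments cond_inj {d A s} [x y a b].
Arguments cond_mono {d A s} [x y a b].
Arguments cond_glue {d A s} [I a] x.

Section ConditionalSets.
Context {d : Order.disp_t} {A : completeBoolType d}.
Implicit Types E F : condSetType A.

(* z = sum x_i|a_i; such a z exists and is unique when a is in p(1) *)
Definition is_csum E (I : Type) (a : I -> A) (x : I -> E) (z : E) : Prop :=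
  forall i, cond z (a i) = cond (x i) (a i).

Definition stable_set E (S : set E) : Prop :=
  S !=set0 /\
  forall (I : Type) (a : I -> A) (x : I -> E) (z : E), cpart a \top ->
    (forall i, S (x i)) -> is_csum a x z -> S z.

Definition shull E (S : set E) : set E :=
  [set x | forall T : set E, stable_set T -> S `<=` T -> T x].

(* stability on a stable subset; a conditional function defined on a stable
   subset is represented by any of its extensions *)
Definition stable_fun_on E F (S : set E) (f : E -> F) : Prop :=
  forall (I : Type) (a : I -> A) (x : I -> E) (z : E), cpart a \top ->
    (forall i, S (x i)) -> is_csum a x z -> is_csum a (f \o x) (f z).

Definition stable_fun E F (f : E -> F) : Prop := stable_fun_on setT f.

Definition cinj_on E F (S : set E) (f : E -> F) : Prop :=
  forall x y, S x -> S y ->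
    (forall a, a <> \bot -> cond x a <> cond y a) ->
    forall a, a <> \bot -> cond (f x) a <> cond (f y) a.

Definition cbij_on E F (S : set E) (T : set F) (f : E -> F) : Prop :=
  [/\ stable_fun_on S f, cinj_on S f & f @` S = T].

(* the collection S|a of the x|b with x in S and b <= a *)
Definition restr E (S : set E) (a : A) : set (obj E) :=
  [set o | exists x b, [/\ S x, b <= a & o = cond x b]].

Definition csub_on E (a : A) (O : set (obj E)) : Prop :=
  exists S : set E, stable_set S /\ O = restr S a.

Definition csub E (O : set (obj E)) : Prop := exists a, csub_on a O.

Definition cnull E : set (obj E) := restr (@setT E) \bot.

(* G is the conditional complement of O *)
Definition is_ccompl E (O G : set (obj E)) : Prop :=
  [/\ csub G, (O `&` G)%classic = @cnull E &
      forall H, csub H -> (O `&` H)%classic = @cnull E -> H `<=` G].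

(* support 1, with o as the zero of E *)
Definition csupport1 E (o : E) : Prop :=
  supremums [set a | exists x : E,
    forall b, b <> \bot -> b <= a -> cond x b <> cond o b] \top.

End ConditionalSets.

Section PartitionTheory.
Context {d : Order.disp_t} {A : completeBoolType d}.
Implicit Types E F : condSetType A.

Lemma supremums_top (I : Type) (a : I -> A) :
  (forall s, (forall i, a i <= s) -> s = \top) -> supremums (range a) \top.
Proof.
move=> h; split; first by move=> x _; exact: lex1.
by move=> s hs; rewrite (h s) // => i; apply: hs; exists i.
Qed.

Lemma cpart_le (I : Type) (a : I -> A) s :
  cpart a \top -> (forall i, a i <= s) -> s = \top.
Proof.
move=> [_ [_ h]] hs; apply/eqP; rewrite -le1x; apply: h.
by move=> _ [i _ <-].
Qed.

Definition bpart (a : A) (b : bool) : A := if b then a else ~` a.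

Lemma cpart_bool a : cpart (bpart a) \top.
Proof.
split; last first.
  apply: supremums_top => s hs; apply/eqP; rewrite -le1x -(joinxC a).
  by rewrite leUx; apply/andP; split; [exact: (hs true)|exact: (hs false)].
by move=> [] [] //= _; rewrite ?meetxC ?meetCx.
Qed.

Lemma cpart_option (I : Type) (a : I -> A) (b : A) : cpart a \top ->
  cpart (fun o => if o is Some i then a i `&` b else ~` b) \top.
Proof.
move=> ha; split.
  move=> [i|] [j|] // h.
  - rewrite meetACA (_ : a i `&` a j = \bot) ?meet0x //.
    by apply: (proj1 ha) => e; apply: h; rewrite e.
  - by rewrite -meetA meetxC meetx0.
  - by rewrite meetCA meetCx meetx0.
apply: supremums_top => s hs.
have hb : ~` b <= s by exact: (hs None).
have : s `|` ~` b = \top.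
  apply: (cpart_le ha) => i; rewrite -[a i]meetx1 -(joinxC b) meetUr.
  by rewrite leU2 // ?leIr // (hs (Some i)).
by move/eqP; rewrite -le1x (join_idPl hb) le1x => /eqP.
Qed.

Lemma cond_eq E (I : Type) (a : I -> A) (x y : E) : cpart a \top ->
  (forall i, cond x (a i) = cond y (a i)) -> x = y.
Proof.
move=> ha h; have [z [hz uz]] := cond_glue (fun=> y) ha.
by rewrite -(uz x) // (uz y).
Qed.

Lemma glue2 E a (x y : E) :
  exists z, cond z a = cond x a /\ cond z (~` a) = cond y (~` a).
Proof.
have [z [hz _]] := cond_glue (fun b => if b then x else y) (cpart_bool a).
by exists z; split; [exact: (hz true)|exact: (hz false)].
Qed.

Lemma cond_eq2 E a (x y : E) :
  cond x a = cond y a -> cond x (~` a) = cond y (~` a) -> x = y.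
Proof. by move=> h1 h2; apply: (cond_eq (cpart_bool a)) => -[]. Qed.

Lemma cond_eqI E (I : Type) (a : I -> A) b (x y : E) : cpart a \top ->
  (forall i, cond x (a i `&` b) = cond y (a i `&` b)) -> cond x b = cond y b.
Proof.
move=> ha h; have [w [wb wb']] := glue2 b x y.
suff -> : y = w by rewrite wb.
apply: (cond_eq (cpart_option b ha)) => -[i|] //.
by rewrite -h; apply/esym/(cond_mono _ wb)/leIr.
Qed.

Lemma cond_bot E (x y : E) : cond x \bot = cond y \bot.
Proof.
have [w [w0]] := glue2 \bot x y; rewrite compl0 => w1.
by rewrite -w0; apply: (cond_mono _ w1); exact: le0x.
Qed.

Lemma cond_top E (x y : E) : cond x \top = cond y \top -> x = y.
Proof.
by move=> h; apply: (@cond_eq2 _ \top) => //; rewrite compl1; exact: cond_bot.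
Qed.

Lemma stable_local E F (f : E -> F) : stable_fun f <->
  forall a x y, cond x a = cond y a -> cond (f x) a = cond (f y) a.
Proof.
split=> [hf a x y h|hf I a x z _ _ h i]; last exact/hf/h.
have hy : is_csum (bpart a) (fun b => if b then x else y) y by case.
by have /(_ true) := hf _ _ _ _ (cpart_bool a) (fun=> Logic.I) hy.
Qed.

Lemma sub_shull E (S : set E) : S `<=` shull S.
Proof. by move=> x Sx T _; exact. Qed.

Lemma shull_id E (S : set E) : stable_set S -> shull S = S.
Proof.
move=> hS; apply/seteqP; split; last exact: sub_shull.
by move=> x; apply.
Qed.

Lemma shull_stable E (S : set E) : S !=set0 -> stable_set (shull S).
Proof.
move=> [x Sx]; split; first by exists x; exact: sub_shull.
move=> I a y z ha hy hz T hT ST; apply: (proj2 hT _ _ _ _ ha _ hz) => i.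
exact: hy.
Qed.

End PartitionTheory.

Section Product.
Context {d : Order.disp_t} {A : completeBoolType d} (E F : condSetType A).

Let pcond (p : E * F) (a : A) : obj E * obj F := (cond p.1 a, cond p.2 a).

Fact prod_inhabited : inhabited (E * F).
Proof.
by have [x] := cset_inhabited E; have [y] := cset_inhabited F.
Qed.

Fact pcond_inj x y a b : pcond x a = pcond y b -> a = b.
Proof. by case=> /cond_inj. Qed.

Fact pcond_mono x y a b : a <= b -> pcond x b = pcond y b ->
  pcond x a = pcond y a.
Proof.
by move=> ab [h1 h2]; congr (_, _); [apply: cond_mono h1|apply: cond_mono h2].
Qed.

Fact pcond_glue (I : Type) (a : I -> A) (x : I -> E * F) : cpart a \top ->
  exists! z, forall i, pcond z (a i) = pcond (x i) (a i).
Proof.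
move=> ha.
have [u [hu uu]] := cond_glue (fun i => (x i).1) ha.
have [v [hv uv]] := cond_glue (fun i => (x i).2) ha.
exists (u, v); split=> [i|[u' v'] h]; first by rewrite /pcond hu hv.
by congr (_, _); [apply: uu|apply: uv] => i; case: (h i).
Qed.

HB.instance Definition _ := isCondSet.Build d A (E * F)%type
  prod_inhabited pcond_inj pcond_mono pcond_glue.

End Product.

(* Formal sums over D.  Terms with equal coefficients are merged, so that a
   formal sum is a family of elements of A indexed by D, the element at p being
   the condition on which the sum equals p; two formal sums which agree on 1 are
   then equal.  See [fsum_condE] for the identification of conditional objects. *)
Record fsum d (A : completeBoolType d) (D : Type) := Fsum {
  fsum_at :> D -> A;
  fsum_cpart : cpart fsum_at \top
}.
Arguments Fsum {d A D}.

Section FormalSums.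
Context {d : Order.disp_t} {A : completeBoolType d} {D : Type}.
Implicit Types x y z : fsum A D.

Definition fsum_cond x (a : A) : A * (D -> A) := (a, fun p => x p `&` a).

Lemma fsum_eq x y : (forall p, x p = y p) -> x = y.
Proof.
case: x y => [x hx] [y hy] /= /funext xy; case: _ / xy in hy *.
by rewrite (Prop_irrelevance hx hy).
Qed.

Fact fsum_cond_inj x y a b : fsum_cond x a = fsum_cond y b -> a = b.
Proof. by case. Qed.

Fact fsum_cond_mono x y a b : a <= b -> fsum_cond x b = fsum_cond y b ->
  fsum_cond x a = fsum_cond y a.
Proof.
move=> ab [/funeqP h]; congr (_, _); apply/funext => p.
by rewrite -(meet_idPr ab) !meetA h.
Qed.

(* p|1 *)
Definition fsum_const (p : D) x : Prop := forall q, x q <> \bot -> q = p.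

Lemma fsum_const_exists p0 : exists x, fsum_const p0 x.
Proof.
have h : cpart (fun p => if `[< p = p0 >] then \top else \bot : A) \top.
  split; last first.
    apply: supremums_top => s /(_ p0); rewrite asboolT //.
    by move=> hs; apply/eqP; rewrite -le1x.
  move=> p q pq; case: asboolP => [e|_]; last by rewrite meet0x.
  by case: asboolP => [e'|_]; rewrite ?meetx0 //; case: pq; rewrite e e'.
by exists (Fsum _ h) => q /=; case: asboolP.
Qed.

Lemma fsum_const_at p x : fsum_const p x -> x p = \top.
Proof.
move=> hx; apply: (cpart_le (fsum_cpart x)) => q.
case: (pselect (x q = \bot)) => [->|/hx ->] //; exact: le0x.
Qed.

Fact fsum_inhabited : inhabited D -> inhabited (fsum A D).
Proof. by move=> [p]; have [x _] := fsum_const_exists p. Qed.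

Fact fsum_cond_glue (I : Type) (a : I -> A) (x : I -> fsum A D) :
  cpart a \top ->
  exists! z, forall i, fsum_cond z (a i) = fsum_cond (x i) (a i).
Proof.
move=> ha.
have /choice [z hz] p := supremums_exist [set x i p `&` a i | i in setT].
have zI p j : z p `&` a j = x j p `&` a j.
  apply/eqP; rewrite eq_le; apply/andP; split; last first.
    by rewrite lexI leIr andbT; apply: (proj1 (hz p)); exists j.
  have h : z p <= (x j p `&` a j) `|` ~` a j.
    apply: (proj2 (hz p)) => _ [i _ <-].
    case: (pselect (i = j)) => [->|ij]; first exact: leUl.
    rewrite lexU2 //; apply/orP; right.
    by rewrite -disj_leC -meetA (proj1 ha) // meetx0.
  have := leI2 h (lexx (a j)).
  by rewrite meetUl meetCx joinx0 -meetA meetxx.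
have zpart : cpart z \top.
  split.
    move=> p q pq; apply/eqP; rewrite disj_leC.
    apply: (proj2 (hz p)) => _ [i _ <-]; rewrite -disj_leC -meetA.
    rewrite [a i `&` z q]meetC zI meetA; apply/eqP.
    by rewrite (proj1 (fsum_cpart (x i))) // meet0x.
  apply: supremums_top => s hs; apply: (cpart_le ha) => i.
  have : s `|` ~` a i = \top.
    apply: (cpart_le (fsum_cpart (x i))) => p.
    rewrite -[x i p]meetx1 -(joinxC (a i)) meetUr leU2 // ?leIr // -zI.
    exact: le_trans (leIl _ _) (hs p).
  move=> h; rewrite -[a i]meet1x -h meetUl meetCx joinx0; exact: leIl.
exists (Fsum z zpart); split=> [i|y hy].
  by congr (_, _); apply/funext => p; exact: zI.
apply: fsum_eq => p /=; apply/eqP; rewrite eq_le; apply/andP; split.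
  apply: (proj2 (hz p)) => _ [i _ <-].
  by case: (hy i) => /funeqP /(_ p) <-; exact: leIl.
have : z p `|` ~` y p = \top.
  apply: (cpart_le ha) => i.
  rewrite -[a i]meet1x -(joinxC (y p)) meetUl leU2 ?leIl //.
  by case: (hy i) => /funeqP /(_ p) ->; rewrite -zI leIl.
move=> h; rewrite -[y p]meet1x -h meetUl meetCx joinx0; exact: leIl.
Qed.

Lemma fsum_condE x y a : fsum_cond x a = fsum_cond y a <->
  forall p q, x p `&` y q `&` a <> \bot -> p = q.
Proof.
split=> [[/funeqP h] p q hpq|h].
  apply: contrapT => pq; apply: hpq.
  rewrite -meetA -[y q `&` a]h meetA.
  by rewrite (proj1 (fsum_cpart x)) // meet0x.
congr (_, _); apply/funext => p.
have le (u v : fsum A D) : (forall q, p <> q -> u p `&` v q `&` a = \bot) ->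
    u p `&` a <= v p `&` a.
  move=> huv; rewrite lexI leIr andbT.
  have : v p `|` ~` (u p `&` a) = \top.
    apply: (cpart_le (fsum_cpart v)) => q.
    case: (pselect (p = q)) => [->|pq]; first exact: leUl.
    rewrite lexU2 //; apply/orP; right; rewrite -disj_leC meetC meetAC.
    by rewrite huv.
  by move=> e; rewrite -[X in X <= _]meet1x -e meetUl meetCx joinx0 leIl.
apply/eqP; rewrite eq_le; apply/andP; split; apply: le => q pq.
  by apply: contrapT => /h.
apply: contrapT; rewrite [y p `&` _]meetC => /h e; exact: pq.
Qed.

(* sum n_i|a_i and sum m_j|b_j satisfy r n_i m_j whenever a_i /\ b_j <> 0 *)
Definition fsum_rel (r : D -> D -> Prop) x y : Prop :=
  forall p q, x p `&` y q <> \bot -> r p q.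

(* z is the result of applying op to x and y componentwise *)
Definition fsum_op (op : D -> D -> D) x y z : Prop :=
  forall p q r, x p `&` y q `&` z r <> \bot -> r = op p q.

Lemma fsum_op_const op p q r x y z : fsum_const p x -> fsum_const q y ->
  fsum_const r z -> r = op p q -> fsum_op op x y z.
Proof.
move=> hx hy hz e0 p' q' r' h.
have [-> -> ->] : [/\ p' = p, q' = q & r' = r] by
  split; [apply: hx|apply: hy|apply: hz] => e; apply: h;
  rewrite e ?meetx0 ?meet0x.
by [].
Qed.

End FormalSums.

Section ConditionalNumbers.
Context {d : Order.disp_t} (A : completeBoolType d).

Definition cN := fsum A {n : nat | (0 < n)%N}.
Definition cQ := fsum A rat.

Fact cN_inhabited : inhabited cN.
Proof. by apply: fsum_inhabited; exact: (inhabits (exist _ 1%N isT)). Qed.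

Fact cQ_inhabited : inhabited cQ.
Proof. by apply: fsum_inhabited; exact: (inhabits 0%R). Qed.

HB.instance Definition _ := isCondSet.Build d A cN cN_inhabited
  (@fsum_cond_inj _ _ _) (@fsum_cond_mono _ _ _) (@fsum_cond_glue _ _ _).

HB.instance Definition _ := isCondSet.Build d A cQ cQ_inhabited
  (@fsum_cond_inj _ _ _) (@fsum_cond_mono _ _ _) (@fsum_cond_glue _ _ _).

Definition cN_le (x y : cN) : Prop :=
  fsum_rel (fun m n => (val m <= val n)%N) x y.

Definition cQ_le (x y : cQ) : Prop := fsum_rel (fun p q => (p <= q)%R) x y.

(* [1 <= k <= n] *)
Definition cN_interval (n : cN) : set cN :=
  shull [set k : cN | (forall o, fsum_const (exist _ 1%N isT) o -> cN_le o k)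
                      /\ cN_le k n].

End ConditionalNumbers.

Definition cfinite d (A : completeBoolType d) (E : condSetType A) (S : set E)
  : Prop := exists (n : cN A) (f : cN A -> E), cbij_on (cN_interval n) S f.

Definition is_ubound (T : Type) (le : T -> T -> Prop) (S : set T) (u : T) :=
  forall x, S x -> le x u.

Definition is_lub (T : Type) (le : T -> T -> Prop) (S : set T) (s : T) :=
  is_ubound le S s /\ forall u, is_ubound le S u -> le s u.

#[short(type="condZmodType")]
HB.structure Definition CondZmod d (A : completeBoolType d) :=
  { E of GRing.Zmodule E & CondSet d A E }.

(* The carrier may be the zero ring, which happens exactly when A is trivial. *)
HB.mixin Record isCReal d (A : completeBoolType d) R
    of GRing.ComPzRing R & CondSet d A R := {
  rle : R -> R -> Prop;
  radd_stable : stable_fun (fun p : R * R => (p.1 + p.2)%R);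
  ropp_stable : stable_fun (fun x : R => (- x)%R);
  rmul_stable : stable_fun (fun p : R * R => (p.1 * p.2)%R);
  cinv_exists : forall r : R, (forall a, a <> \bot -> cond r a <> cond (0%R : R) a) ->
    exists s : R, (r * s)%R = 1%R;
  rle_refl : forall x, rle x x;
  rle_anti : forall x y, rle x y -> rle y x -> x = y;
  rle_trans : forall x y z, rle x y -> rle y z -> rle x z;
  rle_stable : forall (I : Type) (a : I -> A) (x y : I -> R) (u v : R),
    cpart a \top -> (forall i, rle (x i) (y i)) ->
    is_csum a x u -> is_csum a y v -> rle u v;
  rle_add : forall x y z : R, rle x y -> rle (x + z)%R (y + z)%R;
  rmul_ge0 : forall x y : R, rle 0%R x -> rle 0%R y -> rle 0%R (x * y)%R;
  (* r|a <= s|a means r|a + s|a^c <= s, and s|a^c <= r|a^c means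
     s|a^c + r|a <= r *)
  rle_total : forall r s : R, exists a : A, forall t : R,
    cond t a = cond r a -> cond t (~` a) = cond s (~` a) ->
    rle t s /\ rle t r;
  rsup_exists : forall S : set R, stable_set S ->
    (exists u, is_ubound rle S u) -> exists s, is_lub rle S s;
  (* R contains the conditional rationals *)
  cQ_embedding : exists iota : cQ A -> R,
    [/\ stable_fun iota,
        cinj_on setT iota,
        forall x, fsum_const 1%R x -> iota x = 1%R,
        (forall x y z, fsum_op +%R x y z -> iota z = (iota x + iota y)%R) /\
        (forall x y z, fsum_op *%R x y z -> iota z = (iota x * iota y)%R) &
        forall x y, cQ_le x y <-> rle (iota x) (iota y)]
}.

#[short(type="crealType")]
HB.structure Definition CReal d (A : completeBoolType d) :=
  { R of GRing.ComPzRing R & CondSet d A R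
    & isCReal d A R }.

Arguments rle {d A s} x y.
Arguments rle_anti {d A s} [x y].
Arguments rle_trans {d A s} [x] y [z].
Arguments rle_stable {d A s} [I a x y u v].
Arguments rmul_ge0 {d A s} [x y].
Arguments rsup_exists {d A s} [S].

HB.mixin Record isCVSpace d (A : completeBoolType d) (R : crealType A) E
    of GRing.Lmodule R E & CondSet d A E := {
  cadd_stable : stable_fun (fun p : E * E => (p.1 + p.2)%R);
  cscale_stable : stable_fun (fun p : R * E => (p.1 *: p.2)%R)
}.

#[short(type="cvspaceType")]
HB.structure Definition CVSpace d (A : completeBoolType d) (R : crealType A) :=
  { E of GRing.Lmodule R E & CondSet d A E & isCVSpace d A R E }.

Notation "x <=r y" := (rle x y) (at level 70, no associativity).

Local Open Scope ring_scope.

Section ConditionalReals.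
Context {d : Order.disp_t} {A : completeBoolType d} {R : crealType A}.

Definition csup (S : set R) : R := xget 0 (is_lub rle S).

Definition cabs (r : R) : R := csup [set r; - r].

Definition clt (r s : R) : Prop :=
  r <=r s /\ forall a : A, a <> \bot%O -> cond r a <> cond s a.

Definition Rplus : set R := shull [set r | 0 <=r r].

Definition Rplusplus : set R := shull [set r | clt 0 r].

End ConditionalReals.

HB.mixin Record isCNormed d (A : completeBoolType d) (R : crealType A) E
    of GRing.Lmodule R E & CondSet d A E & isCVSpace d A R E := {
  cnorm : E -> R;
  cnorm_ge0 : forall x, Rplus (cnorm x);
  cnorm_stable : stable_fun cnorm;
  cnormZ : forall (r : R) x, cnorm (r *: x) = cabs r * cnorm x;
  cnormD : forall x y, cnorm (x + y) <=r cnorm x + cnorm y;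
  cnorm_eq0 : forall x, cnorm x = 0 -> x = 0
}.

#[short(type="cnormedType")]
HB.structure Definition CNormed d (A : completeBoolType d) (R : crealType A) :=
  { E of GRing.Lmodule R E & CondSet d A E & isCVSpace d A R E
    & isCNormed d A R E }.

Section RealTheory.
Context {d : Order.disp_t} {A : completeBoolType d} {R : crealType A}.
Implicit Types (r s t x y z u v w : R) (a b : A).

Lemma radd_loc a x x' y y' : cond x a = cond x' a -> cond y a = cond y' a ->
  cond (x + y) a = cond (x' + y') a.
Proof.
move=> hx hy; have /stable_local h := @radd_stable d A R.
by apply: (h a (x, y) (x', y')); congr (_, _).
Qed.

Lemma rmul_loc a x x' y y' : cond x a = cond x' a -> cond y a = cond y' a ->
  cond (x * y) a = cond (x' * y') a.
Proof.
move=> hx hy; have /stable_local h := @rmul_stable d A R.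
by apply: (h a (x, y) (x', y')); congr (_, _).
Qed.

Lemma ropp_loc a x x' : cond x a = cond x' a -> cond (- x) a = cond (- x') a.
Proof. by have /stable_local h := @ropp_stable d A R; exact: h. Qed.

Lemma rle_sub x y : x <=r y <-> 0 <=r y - x.
Proof.
split=> h; first by rewrite -(subrr x); exact: rle_add.
by rewrite -[x]add0r -[y](subrK x); exact: rle_add.
Qed.

Lemma rle_add2 x y z t : x <=r y -> z <=r t -> x + z <=r y + t.
Proof.
move=> h h'; apply: (rle_trans (y + z)); first exact: rle_add.
by rewrite addrC [y + t]addrC; exact: rle_add.
Qed.

Lemma rle_mul2l x y z : 0 <=r z -> x <=r y -> z * x <=r z * y.
Proof.
move=> hz /rle_sub hxy; apply/rle_sub; rewrite -mulrBr; exact: rmul_ge0.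
Qed.

Lemma rle_mul2r x y z : 0 <=r z -> x <=r y -> x * z <=r y * z.
Proof. by rewrite ![_ * z]mulrC; exact: rle_mul2l. Qed.

(* x|a <= y|a *)
Definition rle_on a x y : Prop :=
  exists x' y', [/\ x' <=r y', cond x' a = cond x a & cond y' a = cond y a].

Lemma rle_on_le a x y : x <=r y -> rle_on a x y.
Proof. by move=> h; exists x, y. Qed.

Lemma rle_on_eq a x y x' y' : cond x a = cond x' a -> cond y a = cond y' a ->
  rle_on a x y -> rle_on a x' y'.
Proof. by move=> hx hy [u [v [h hu hv]]]; exists u, v; rewrite hu hv. Qed.

Lemma rle_part (I : Type) (a : I -> A) x y : cpart a \top ->
  (forall i, rle_on (a i) x y) -> x <=r y.
Proof.
move=> ha /choice [x' /choice [y' h]].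
by apply: (@rle_stable _ _ R _ a x' y' _ _ ha) => i; have [h1 h2 h3] := h i.
Qed.

Lemma rle_case a x y : rle_on a x y -> rle_on (~` a)%O x y -> x <=r y.
Proof. by move=> h1 h2; apply: (rle_part (cpart_bool a)) => -[]. Qed.

Lemma rle_dicho r s : exists a, rle_on a r s /\ rle_on (~` a)%O s r.
Proof.
have [a ha] := rle_total r s; exists a.
have [t [t1 t2]] := glue2 a r s.
by have [h1 h2] := ha t t1 t2; split; [exists t, s|exists t, r].
Qed.

Lemma stable_le r : stable_set [set x | x <=r r].
Proof.
split; first by exists r; exact: rle_refl.
by move=> I a x z ha h hz; apply: (rle_stable ha h hz).
Qed.

Lemma stable_ge r : stable_set [set x | r <=r x].
Proof.
split; first by exists r; exact: rle_refl.
by move=> I a x z ha h hz; apply: (rle_stable ha h _ hz).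
Qed.

Lemma RplusE : Rplus = [set r : R | 0 <=r r].
Proof. by rewrite /Rplus shull_id //; exact: stable_ge. Qed.

Lemma ubound_shull (S : set R) u :
  is_ubound rle (shull S) u <-> is_ubound rle S u.
Proof.
split=> h x; first by move=> /sub_shull /h.
by move=> /(_ _ (stable_le u)); apply; exact: h.
Qed.

Lemma lub_shull (S : set R) s : is_lub rle (shull S) s <-> is_lub rle S s.
Proof.
by split=> -[/ubound_shull h1 h2]; split=> // u /ubound_shull /h2.
Qed.

Lemma csupP (S : set R) s : is_lub rle S s -> csup S = s.
Proof.
move=> hs; rewrite /csup; case: xgetP => [t -> ht|/(_ s)] //.
by apply: rle_anti; [apply: (proj2 ht); case: hs|apply: (proj2 hs); case: ht].
Qed.

Lemma csup_shull (S : set R) u : S !=set0 -> is_ubound rle S u ->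
  is_lub rle S (csup (shull S)).
Proof.
move=> S0 hu; have [|s hs] := rsup_exists (shull_stable S0).
  by exists u; apply/ubound_shull.
by rewrite (csupP hs); apply/lub_shull.
Qed.

(* absolute value *)

Lemma cabs_glue r : exists a, [/\ rle_on a (- r) r, rle_on (~` a)%O r (- r),
  cond (cabs r) a = cond r a & cond (cabs r) (~` a)%O = cond (- r) (~` a)%O].
Proof.
have [a [h1 h2]] := rle_dicho (- r) r; exists a.
have [t [ht ht']] := glue2 a r (- r).
suff -> : cabs r = t by [].
apply: csupP; split=> [x [] -> /=|u hu].
- apply: (@rle_case a); first by apply: rle_on_eq (rle_on_le _ (rle_refl r)).
  by apply: rle_on_eq h2.
- apply: (@rle_case a); first by apply: rle_on_eq h1.
  by apply: rle_on_eq (rle_on_le _ (rle_refl (- r))).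
- have h : r <=r u by apply: hu; left.
  have h' : - r <=r u by apply: hu; right.
  by apply: (@rle_case a); [apply: rle_on_eq (rle_on_le _ h)|
                            apply: rle_on_eq (rle_on_le _ h')].
Qed.

Lemma cabs_lub r : is_lub rle [set r; - r] (cabs r).
Proof.
have [a [h1 h2 ht ht']] := cabs_glue r.
split=> [x [] -> /=|u hu].
- apply: (@rle_case a); first by apply: rle_on_eq (rle_on_le _ (rle_refl r)).
  by apply: rle_on_eq h2.
- apply: (@rle_case a); first by apply: rle_on_eq h1.
  by apply: rle_on_eq (rle_on_le _ (rle_refl (- r))).
- have h : r <=r u by apply: hu; left.
  have h' : - r <=r u by apply: hu; right.
  by apply: (@rle_case a); [apply: rle_on_eq (rle_on_le _ h)|
                            apply: rle_on_eq (rle_on_le _ h')].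
Qed.

Lemma cabs_ge r : r <=r cabs r.
Proof. by apply: (proj1 (cabs_lub r)); left. Qed.

Lemma cabs_geN r : - r <=r cabs r.
Proof. by apply: (proj1 (cabs_lub r)); right. Qed.

Lemma cabs_le r u : r <=r u -> - r <=r u -> cabs r <=r u.
Proof. by move=> h h'; apply: (proj2 (cabs_lub r)) => x [] ->. Qed.

Lemma cabsN r : cabs (- r) = cabs r.
Proof.
by apply: rle_anti; apply: cabs_le; rewrite ?opprK;
  do [exact: cabs_ge|exact: cabs_geN|
      rewrite -{1}[r]opprK; exact: cabs_geN|exact: cabs_ge].
Qed.

Lemma real_half : exists h : R, 0 <=r h /\ h + h = 1.
Proof.
have [iota [_ _ h1 [hD _] hle]] := @cQ_embedding d A R.
have [c1 hc1] := @fsum_const_exists d A rat 1.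
have [c0 hc0] := @fsum_const_exists d A rat 0.
have [c2 hc2] := @fsum_const_exists d A rat 2^-1.
have i0 : iota c0 = 0.
  apply: (addrI (iota c0)).
  by rewrite -(hD _ _ c0 (fsum_op_const hc0 hc0 hc0 _)) ?addr0.
exists (iota c2); split; last by rewrite -(hD _ _ c1 (fsum_op_const hc2 hc2 hc1 _)) ?h1.
rewrite -i0; apply/hle => p q hpq.
have -> : p = 0 by apply: hc0 => e; apply: hpq; rewrite e meet0x.
have -> : q = 2^-1 by apply: hc2 => e; apply: hpq; rewrite e meetx0.
by rewrite Num.Theory.invr_ge0 Num.Theory.ler0n.
Qed.

Lemma r1_neq0 a : a <> \bot%O -> cond (1 : R) a <> cond (0 : R) a.
Proof.
have [iota [_ hinj h1 [hD _] hle]] := @cQ_embedding d A R.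
have [c1 hc1] := @fsum_const_exists d A rat 1.
have [c0 hc0] := @fsum_const_exists d A rat 0.
have i0 : iota c0 = 0.
  apply: (addrI (iota c0)).
  by rewrite -(hD _ _ c0 (fsum_op_const hc0 hc0 hc0 _)) ?addr0.
rewrite -i0 -(h1 _ hc1); apply: hinj => // b hb /fsum_condE h.
have := h 1 0; rewrite (fsum_const_at hc1) (fsum_const_at hc0) !meet1x.
by move=> /(_ hb) /eqP; rewrite oner_eq0.
Qed.

Lemma rle_double t : 0 <=r t + t -> 0 <=r t.
Proof.
move=> ht; have [h [h0 h1]] := real_half.
by rewrite -[t]mul1r -h1 mulrDl -mulrDr; exact: rmul_ge0.
Qed.

Lemma cabs_ge0 r : 0 <=r cabs r.
Proof.
apply: rle_double; rewrite -(subrr r).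
by apply: rle_add2; [exact: cabs_ge|exact: cabs_geN].
Qed.

Lemma r01 : 0 <=r (1 : R).
Proof. by have [h [h0 <-]] := real_half; rewrite -[0]addr0; exact: rle_add2. Qed.

Lemma cabs_id r : 0 <=r r -> cabs r = r.
Proof.
move=> hr; apply: rle_anti; last exact: cabs_ge.
apply: cabs_le; first exact: rle_refl.
apply: (rle_trans 0) => //; apply/rle_sub; by rewrite sub0r opprK.
Qed.

Lemma cabs0 : cabs 0 = 0 :> R.
Proof. by apply: cabs_id; exact: rle_refl. Qed.

Lemma cabs_eq0 r : cabs r <=r 0 -> r = 0.
Proof.
move=> h; apply: rle_anti; first exact: (rle_trans _ (cabs_ge r) h).
by have /rle_sub := rle_trans _ (cabs_geN r) h; rewrite sub0r opprK.
Qed.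

Lemma cabsD r s : cabs (r + s) <=r cabs r + cabs s.
Proof.
apply: cabs_le; first by apply: rle_add2; exact: cabs_ge.
by rewrite opprD; apply: rle_add2; exact: cabs_geN.
Qed.

Lemma cabsM r s : cabs (r * s) = cabs r * cabs s.
Proof.
have le1 (x y : R) : x * y <=r cabs x * cabs y.
  apply/rle_sub/rle_double.
  have -> : cabs x * cabs y - x * y + (cabs x * cabs y - x * y) =
    (cabs x - x) * (cabs y - - y) + (cabs x - - x) * (cabs y - y) by ring.
  rewrite -[0]addr0; apply: rle_add2; apply: rmul_ge0;
    by [exact: (proj1 (rle_sub _ _) (cabs_ge _))
       |exact: (proj1 (rle_sub _ _) (cabs_geN _))].
have le2 (x y : R) : x * cabs y <=r cabs (x * y).
  have [b [_ _ hb hb']] := cabs_glue y; apply: (@rle_case b).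
    apply: rle_on_eq (rle_on_le _ (cabs_ge (x * y))) => //.
    exact/esym/rmul_loc.
  apply: rle_on_eq (rle_on_le _ (cabs_geN (x * y))) => //.
  by rewrite -mulrN; exact/esym/rmul_loc.
apply: rle_anti.
  apply: cabs_le; first exact: le1.
  by rewrite -mulNr -[cabs r]cabsN; exact: le1.
have [a [_ _ ha ha']] := cabs_glue r; apply: (@rle_case a).
  apply: rle_on_eq (rle_on_le _ (le2 r s)) => //.
  exact/esym/rmul_loc.
apply: rle_on_eq (rle_on_le _ (le2 (- r) s)); first exact/esym/rmul_loc.
by rewrite mulNr cabsN.
Qed.

Lemma cabs_stable : stable_fun (@cabs d A R).
Proof.
apply/stable_local => a x y hxy.
have [t [t1 t2]] := glue2 a (cabs y) (cabs x).
suff -> : cabs x = t by rewrite t1.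
have [z [z1 z2]] := glue2 a (cabs x) (cabs y).
have xt : cabs x <=r t.
  apply: cabs_le; apply: (@rle_case a).
  - by apply: rle_on_eq (rle_on_le _ (cabs_ge y)).
  - by apply: rle_on_eq (rle_on_le _ (cabs_ge x)).
  - by apply: rle_on_eq (rle_on_le _ (cabs_geN y)) => //; exact: ropp_loc.
  - by apply: rle_on_eq (rle_on_le _ (cabs_geN x)).
have yz : cabs y <=r z.
  apply: cabs_le; apply: (@rle_case a).
  - by apply: rle_on_eq (rle_on_le _ (cabs_ge x)).
  - by apply: rle_on_eq (rle_on_le _ (cabs_ge y)).
  - by apply: rle_on_eq (rle_on_le _ (cabs_geN x)) => //; exact: ropp_loc.
  - by apply: rle_on_eq (rle_on_le _ (cabs_geN y)).
apply: rle_anti => //; apply: (@rle_case a).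
  by apply: rle_on_eq (rle_on_le _ yz).
by apply: rle_on_eq (rle_on_le _ (rle_refl t)).
Qed.

Lemma rsqr_ge0 r : 0 <=r r * r.
Proof.
suff -> : r * r = cabs r * cabs r by apply: rmul_ge0; exact: cabs_ge0.
have [a [_ _ h1 h2]] := cabs_glue r; apply: (@cond_eq2 _ _ _ a).
  by apply/esym/rmul_loc.
by rewrite -mulrNN; apply/esym/rmul_loc.
Qed.

Lemma clt_inv r : clt 0 r -> exists s, 0 <=r s /\ r * s = 1.
Proof.
move=> [h0 h1]; have [|s hs] := @cinv_exists d A R r.
  by move=> a /h1 h e; apply: h.
exists s; split=> //; rewrite -[s]mul1r -hs -mulrA.
by apply: rmul_ge0 => //; exact: rsqr_ge0.
Qed.

Lemma clt01 : clt 0 (1 : R).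
Proof.
by split; [exact: r01|move=> a /r1_neq0 h e; apply: h].
Qed.

Lemma clt_addl r s : 0 <=r r -> clt 0 s -> clt 0 (r + s).
Proof.
move=> hr [s0 s1]; split; first by rewrite -[0]addr0; exact: rle_add2.
move=> a a0 e; apply: (s1 a a0).
have [t [t1 t2]] := glue2 a s 0; rewrite -t1; congr (cond _ a).
apply: rle_anti; apply: (@rle_case a).
- by apply: rle_on_eq (rle_on_le _ s0).
- by apply: rle_on_eq (rle_on_le _ (rle_refl 0)).
- have h : s <=r r + s by rewrite -{1}[s]add0r; exact: rle_add.
  by apply: rle_on_eq (rle_on_le _ h).
- by apply: rle_on_eq (rle_on_le _ (rle_refl 0)).
Qed.

Lemma clt_half (h e : R) : 0 <=r h -> h + h = 1 -> clt 0 e -> clt 0 (h * e).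
Proof.
move=> h0 h1 [e0 e1]; split; first exact: rmul_ge0.
move=> a a0 he; apply: (e1 a a0).
by rewrite -[e]mul1r -h1 mulrDl -[0]addr0; apply: radd_loc.
Qed.

Lemma rle0_eps u : (forall e, clt 0 e -> u <=r e) -> u <=r 0.
Proof.
move=> hu; pose S := [set w : R | forall e, clt 0 e -> w <=r e].
have hS : stable_set S.
  split; first by exists u.
  move=> I a x z ha hx hz e he.
  by apply: (rle_stable ha _ hz) => [i|]; [exact: hx he|].
have [|s [s1 s2]] := rsup_exists hS; first by exists 1 => w; apply; exact: clt01.
have Ss : S s by move=> e he; apply: s2 => w; exact.
have [h [h0 h1]] := real_half.
have /s1 hss : S (s + s).
  move=> e he; have hs := Ss _ (clt_half h0 h1 he).
  have := rle_add2 hs hs.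
  by rewrite -mulrDl h1 mul1r.
apply: (rle_trans _ (s1 u hu)); apply/rle_sub; rewrite sub0r.
by move/rle_sub: hss; rewrite opprD addrA subrr add0r.
Qed.

End RealTheory.

Section NormedTheory.
Context {d : Order.disp_t} {A : completeBoolType d} {R : crealType A}.
Context {E : cnormedType R}.
Implicit Types x y : E.

Definition cball : set E := shull [set x | cnorm x <=r 1].

Lemma cnorm_ge x : 0 <=r cnorm x.
Proof. by have := cnorm_ge0 x; rewrite RplusE. Qed.

Lemma cnorm0 : cnorm (0 : E) = 0.
Proof. by rewrite -(scale0r (0 : E)) cnormZ cabs0 mul0r. Qed.

Lemma cballE : cball = [set x | cnorm x <=r 1].
Proof.
apply: shull_id; split; first by exists 0 => /=; rewrite cnorm0; exact: r01.
move=> I a x z ha hx hz; apply: (rle_stable ha hx); last by move=> i.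
by apply: (@cnorm_stable _ _ _ E) hz.
Qed.

Definition dual_pred (f : E -> R) : Prop :=
  [/\ stable_fun f, scalar f &
      exists r : R, forall x, cabs (f x) <=r r * cnorm x].

End NormedTheory.

Arguments cball {d A R} E.

Record dual d (A : completeBoolType d) (R : crealType A) (E : cnormedType R) :=
  Dual { dual_fun :> E -> R; dualP : dual_pred dual_fun }.
Arguments Dual {d A R E}.

Section Dual.
Context {d : Order.disp_t} {A : completeBoolType d} {R : crealType A}.
Context {E : cnormedType R}.
Implicit Types (f g : dual E) (x y : E) (r : R).

Lemma dual_eq f g : (forall x, f x = g x) -> f = g.
Proof.
case: f g => [f hf] [g hg] /= /funext fg; case: _ / fg in hg *.
by rewrite (Prop_irrelevance hf hg).
Qed.

Lemma dual_loc f (a : A) x y : cond x a = cond y a ->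
  cond (f x) a = cond (f y) a.
Proof. by case: (dualP f) => /stable_local h _ _; exact: h. Qed.

Lemma dualL f r x y : f (r *: x + y) = r * f x + f y.
Proof. by have [_ h _] := dualP f; exact: h. Qed.

Lemma dual0 f : f 0 = 0.
Proof.
by apply: (addrI (f 0)); rewrite addr0 -{1}[f 0]mul1r -dualL scale1r addr0.
Qed.

Lemma dualZ f r x : f (r *: x) = r * f x.
Proof. by rewrite -[r *: x]addr0 dualL dual0 addr0. Qed.

Lemma dualD f x y : f (x + y) = f x + f y.
Proof. by rewrite -[x]scale1r dualL mul1r scale1r. Qed.

Fact dual_zero_subproof : dual_pred (fun _ : E => 0 : R).
Proof.
split; first by apply/stable_local.
  by move=> r x y; rewrite mulr0 addr0.
by exists 0 => x; rewrite cabs0 mul0r; exact: rle_refl.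
Qed.

Fact dual_opp_subproof f : dual_pred (fun x => - f x).
Proof.
split; first by apply/stable_local => a x y h; apply/ropp_loc/dual_loc.
  by move=> r x y; rewrite dualL opprD mulrN.
by have [_ _ [r hr]] := dualP f; exists r => x; rewrite cabsN.
Qed.

Fact dual_add_subproof f g : dual_pred (fun x => f x + g x).
Proof.
split; first by apply/stable_local => a x y h; apply: radd_loc; exact: dual_loc.
  by move=> r x y; rewrite !dualL; ring.
have [_ _ [r hr]] := dualP f; have [_ _ [s hs]] := dualP g.
exists (r + s) => x; apply: (rle_trans _ (cabsD _ _)).
by rewrite mulrDl; exact: rle_add2.
Qed.

Fact dual_scale_subproof r f : dual_pred (fun x => r * f x).
Proof.
split; first by apply/stable_local => a x y h; apply: rmul_loc; first exact; exact: dual_loc.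
  by move=> s x y; rewrite /= dualL; ring.
have [_ _ [s hs]] := dualP f; exists (cabs r * s) => x.
by rewrite cabsM -mulrA; apply: rle_mul2l => //; exact: cabs_ge0.
Qed.

Definition dual_zero := Dual _ dual_zero_subproof.
Definition dual_opp f := Dual _ (dual_opp_subproof f).
Definition dual_add f g := Dual _ (dual_add_subproof f g).
Definition dual_scale r f := Dual _ (dual_scale_subproof r f).

Fact dual_addA : associative dual_add.
Proof. by move=> f g h; apply: dual_eq => x /=; rewrite addrA. Qed.

Fact dual_addC : commutative dual_add.
Proof. by move=> f g; apply: dual_eq => x /=; rewrite addrC. Qed.

Fact dual_add0 : left_id dual_zero dual_add.
Proof. by move=> f; apply: dual_eq => x /=; rewrite add0r. Qed.

Fact dual_addN : left_inverse dual_zero dual_opp dual_add.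
Proof. by move=> f; apply: dual_eq => x /=; rewrite addNr. Qed.

HB.instance Definition _ := gen_eqMixin (dual E).
HB.instance Definition _ := gen_choiceMixin (dual E).
HB.instance Definition _ :=
  GRing.isZmodule.Build (dual E) dual_addA dual_addC dual_add0 dual_addN.

Fact dual_scaleA r s f : dual_scale r (dual_scale s f) = dual_scale (r * s) f.
Proof. by apply: dual_eq => x /=; rewrite mulrA. Qed.

Fact dual_scale1 : left_id 1 dual_scale.
Proof. by move=> f; apply: dual_eq => x /=; rewrite mul1r. Qed.

Fact dual_scaleDr : right_distributive dual_scale +%R.
Proof. by move=> r f g; apply: dual_eq => x /=; rewrite mulrDr. Qed.

Fact dual_scaleDl f : {morph dual_scale^~ f : r s / r + s}.
Proof. by move=> r s; apply: dual_eq => x /=; rewrite mulrDl. Qed.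

HB.instance Definition _ := GRing.Zmodule_isLmodule.Build R (dual E)
  dual_scaleA dual_scale1 dual_scaleDr dual_scaleDl.

(* f|a is the function x |-> f(x)|a *)
Definition dual_cond f (a : A) : E -> obj R := fun x => cond (f x) a.

Fact dual_inhabited : inhabited (dual E).
Proof. exact: (inhabits dual_zero). Qed.

Fact dual_cond_inj f g (a b : A) : dual_cond f a = dual_cond g b -> a = b.
Proof. by move=> /funeqP /(_ 0) /cond_inj. Qed.

Fact dual_cond_mono f g (a b : A) : (a <= b)%O ->
  dual_cond f b = dual_cond g b -> dual_cond f a = dual_cond g a.
Proof.
by move=> ab /funeqP h; apply/funext => x; apply: (cond_mono ab); exact: h.
Qed.

Fact dual_cond_glue (I : Type) (a : I -> A) (f : I -> dual E) :
  cpart a \top%O ->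
  exists! g, forall i, dual_cond g (a i) = dual_cond (f i) (a i).
Proof.
move=> ha.
have /choice [g hg] x : exists z, is_csum a (fun i => f i x) z.
  by have [z [hz _]] := cond_glue (fun i => f i x) ha; exists z.
have hR i : exists r, forall x, cabs (f i x) <=r r * cnorm x.
  by case: (dualP (f i)).
have [r hr] := choice hR.
have [s [hs _]] := cond_glue r ha.
have gP : dual_pred g.
  split.
  - apply/stable_local => b x y hxy; apply: (cond_eqI ha) => i.
    transitivity (cond (f i x) (a i `&` b)%O).
      by apply: (cond_mono _ (hg x i)); exact: leIl.
    transitivity (cond (f i y) (a i `&` b)%O).
      by apply: dual_loc; apply: (cond_mono _ hxy); exact: leIr.
    by apply/esym/(cond_mono _ (hg y i)); exact: leIl.
  - move=> t x y; apply: (cond_eq ha) => i; rewrite (hg (t *: x + y) i) dualL.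
    by apply/esym/radd_loc; [apply: rmul_loc|]; rewrite ?(hg _ i).
  - exists s => x; apply: (rle_part ha) => i.
    apply: rle_on_eq (rle_on_le _ (hr i x)).
      by have /stable_local := @cabs_stable _ _ R; apply; rewrite (hg x i).
    by apply: rmul_loc; rewrite ?(hs i).
exists (Dual g gP); split=> [i|h hh]; first by apply/funext => x; exact: hg.
apply: dual_eq => x; apply: (cond_eq ha) => i /=; rewrite (hg x i).
by have /funeqP /(_ x) e := hh i; exact: esym e.
Qed.

HB.instance Definition _ := isCondSet.Build d A (dual E)
  dual_inhabited dual_cond_inj dual_cond_mono dual_cond_glue.

Fact dual_add_stable : stable_fun (fun p : dual E * dual E => p.1 + p.2).
Proof.
apply/stable_local => a [f g] [f' g'] [/funeqP hf /funeqP hg].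
by apply/funext => x; apply: radd_loc; [exact: hf|exact: hg].
Qed.

Fact dual_scale_stable : stable_fun (fun p : R * dual E => p.1 *: p.2).
Proof.
apply/stable_local => a [r f] [s g] [hr /funeqP hf].
by apply/funext => x; apply: rmul_loc; [exact: hr|exact: hf].
Qed.

HB.instance Definition _ := isCVSpace.Build d A R (dual E)
  dual_add_stable dual_scale_stable.

(* sup [ |f(x)| : x in B_E ] *)
Definition dual_norm f : R := csup (shull [set cabs (f x) | x in cball E]).

Lemma dual_norm_lub f : is_lub rle [set cabs (f x) | x in cball E] (dual_norm f).
Proof.
have [_ _ [r hr]] := dualP f; apply: (@csup_shull _ _ _ _ (cabs r)).
  exists (cabs (f 0)); exists 0 => //; rewrite cballE /= cnorm0; exact: r01.
move=> _ [x + <-]; rewrite cballE /= => hx.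
apply: (rle_trans _ (hr x)); rewrite -[cabs r]mulr1.
apply: (rle_trans (cabs r * cnorm x)).
  by apply: rle_mul2r; [exact: cnorm_ge|exact: cabs_ge].
by apply: rle_mul2l => //; exact: cabs_ge0.
Qed.

Lemma dual_norm_ub f x : cnorm x <=r 1 -> cabs (f x) <=r dual_norm f.
Proof.
by move=> hx; apply: (proj1 (dual_norm_lub f)); exists x; rewrite ?cballE.
Qed.

Lemma dual_norm_le f u : (forall x, cnorm x <=r 1 -> cabs (f x) <=r u) ->
  dual_norm f <=r u.
Proof.
move=> h; apply: (proj2 (dual_norm_lub f)) => _ [x + <-].
by rewrite cballE; exact: h.
Qed.

Lemma dual_norm_ge f : 0 <=r dual_norm f.
Proof.
apply: (rle_trans _ (cabs_ge0 (f 0))); apply: dual_norm_ub.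
by rewrite cnorm0; exact: r01.
Qed.

Lemma dual_normP f x : cabs (f x) <=r dual_norm f * cnorm x.
Proof.
set K := dual_norm f + 1.
have [k [k0 hk]] : exists k, 0 <=r k /\ K * k = 1.
  by apply: clt_inv; apply: clt_addl; [exact: dual_norm_ge|exact: clt01].
have K0 : 0 <=r K.
  by rewrite -[0]addr0; apply: rle_add2; [exact: dual_norm_ge|exact: r01].
apply/rle_sub; set D := _ - _.
suff : - D * k <=r 0.
  move=> /(rle_mul2r K0); rewrite mul0r -mulrA [k * K]mulrC hk mulr1.
  by move/rle_sub; rewrite sub0r opprK.
apply: rle0_eps => e he.
have [s [s0 hs]] := clt_inv (clt_addl (cnorm_ge x) he).
have ne0 : 0 <=r cnorm x + e.
  by rewrite -[0]addr0; apply: rle_add2; [exact: cnorm_ge|case: he].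
have h1 : cabs (f x) <=r dual_norm f * (cnorm x + e).
  have : cabs (f (s *: x)) <=r dual_norm f.
    apply: dual_norm_ub; rewrite cnormZ cabs_id // -hs mulrC.
    apply: rle_mul2r => //; rewrite -{1}[cnorm x]addr0.
    by apply: rle_add2; [exact: rle_refl|case: he].
  rewrite dualZ cabsM (cabs_id s0) => /(rle_mul2r ne0).
  by rewrite mulrAC [s * _]mulrC hs mul1r.
have h2 : - D <=r e * K.
  apply/rle_sub; have /rle_sub h3 := h1.
  have -> : e * K - - D =
    (dual_norm f * (cnorm x + e) - cabs (f x)) + e by rewrite /D /K; ring.
  by rewrite -[0]addr0; apply: rle_add2 => //; case: he.
by rewrite -[e]mulr1 -hk mulrA; apply: rle_mul2r.
Qed.

Fact dual_norm_ge0 f : Rplus (dual_norm f).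
Proof. by rewrite RplusE; exact: dual_norm_ge. Qed.

Fact dual_norm_stable : stable_fun dual_norm.
Proof.
move=> I a f g ha _ hfg i; move: i.
have [n [hn _]] := cond_glue (fun i => dual_norm (f i)) ha.
suff -> : dual_norm g = n by exact: hn.
have hg x i : cond (g x) (a i) = cond (f i x) (a i).
  by have /funeqP := hfg i; exact.
have habs x i : cond (cabs (g x)) (a i) = cond (cabs (f i x)) (a i).
  by have /stable_local := @cabs_stable _ _ R; apply.
apply: rle_anti.
  apply: dual_norm_le => x hx; apply: (rle_part ha) => i.
  apply: rle_on_eq (rle_on_le _ (dual_norm_ub (f i) hx)); first by rewrite habs.
  by rewrite (hn i).
apply: (rle_part ha) => i.
have [m [m1 m2]] := glue2 (a i) (dual_norm g) (dual_norm (f i)).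
have hm : dual_norm (f i) <=r m.
  apply: dual_norm_le => x hx; apply: (@rle_case _ _ _ (a i)).
    by apply: rle_on_eq (rle_on_le _ (dual_norm_ub g hx)) => //; rewrite habs.
  by apply: rle_on_eq (rle_on_le _ (dual_norm_ub (f i) hx)).
by apply: rle_on_eq (rle_on_le _ hm) => //; rewrite (hn i).
Qed.

Fact dual_normZ r f : dual_norm (r *: f) = cabs r * dual_norm f.
Proof.
apply: rle_anti.
  apply: dual_norm_le => x hx /=; rewrite cabsM.
  by apply: rle_mul2l; [exact: cabs_ge0|exact: dual_norm_ub].
set K := cabs r + 1.
have [k [k0 hk]] : exists k, 0 <=r k /\ K * k = 1.
  by apply: clt_inv; apply: clt_addl; [exact: cabs_ge0|exact: clt01].
have K0 : 0 <=r K.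
  by rewrite -[0]addr0; apply: rle_add2; [exact: cabs_ge0|exact: r01].
have h : dual_norm f <=r k * (dual_norm (r *: f) + dual_norm f).
  apply: dual_norm_le => x hx.
  rewrite -[cabs (f x)]mul1r -hk [K * k]mulrC -mulrA; apply: rle_mul2l => //.
  rewrite /K mulrDl mul1r -cabsM.
  by apply: rle_add2; [exact: (dual_norm_ub (r *: f))|exact: dual_norm_ub].
have := rle_mul2l K0 h; rewrite mulrA hk mul1r /K mulrDl mul1r.
by move=> h'; have := rle_add _ _ (- dual_norm f) h'; rewrite !addrK.
Qed.

Fact dual_normD f g : dual_norm (f + g) <=r dual_norm f + dual_norm g.
Proof.
apply: dual_norm_le => x hx /=; apply: (rle_trans _ (cabsD _ _)).
by apply: rle_add2; exact: dual_norm_ub.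
Qed.

Fact dual_norm_eq0 f : dual_norm f = 0 -> f = 0.
Proof.
move=> h; apply: dual_eq => x; apply: cabs_eq0.
by have := dual_normP f x; rewrite h mul0r.
Qed.

HB.instance Definition _ := isCNormed.Build d A R (dual E)
  dual_norm_ge0 dual_norm_stable dual_normZ dual_normD dual_norm_eq0.

End Dual.

Section Bidual.
Context {d : Order.disp_t} {A : completeBoolType d} {R : crealType A}.
Variable E : cnormedType R.

Definition bidual : cnormedType R := dual (dual E).

Fact cembed_subproof (x : E) : dual_pred (fun f : dual E => f x).
Proof.
split; first by apply/stable_local => a f g /funeqP; exact.
  by [].
by exists (cnorm x) => f; rewrite mulrC; exact: dual_normP.
Qed.

Definition cembed (x : E) : bidual := Dual _ (cembed_subproof x).

(* U_{G,r} *)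
Definition sigma_nbhs (G : set (dual E)) (r : R) : set bidual :=
  shull [set y : bidual |
    csup (shull [set cabs ((y : dual (dual E)) g) | g in G]) <=r r].

Definition sigma_open (O : set (obj bidual)) : Prop :=
  exists a : A, csub_on a O /\
    forall z : bidual, O (cond z a) ->
      exists (G : set (dual E)) (r : R),
        [/\ stable_set G, cfinite G, Rplusplus r &
            restr [set z + u | u in sigma_nbhs G r] a `<=` O].

Definition sigma_closed (C : set (obj bidual)) : Prop :=
  csub C /\ exists O, is_ccompl C O /\ sigma_open O.

Definition sigma_closure (S : set (obj bidual)) : set (obj bidual) :=
  [set o | forall C, sigma_closed C -> S `<=` C -> C o].

(* conditional closure of S in the conditional subset B: the closed conditional
   subsets of B are the traces on B of the closed ones of E^** *)
Definition sigma_closure_in (B S : set (obj bidual)) : set (obj bidual) :=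
  B `&` sigma_closure S.

End Bidual.

(* Main.v *)
Require Import Defs.
From HB Require Import structures.
From mathcomp Require Import all_boot all_order all_algebra.
From mathcomp Require Import ring boolp classical_sets.

Set Implicit Arguments.
Unset Strict Implicit.
Unset Printing Implicit Defensive.

Import Order.Theory GRing.Theory.

Local Open Scope classical_set_scope.
Local Open Scope ring_scope.

(** Goldstine's theorem rests on Helly's lemma: for finitely many functionals
    g_i, a point z of the bidual ball and e > 0, some x in the unit ball has
    |g_i(x) - z(g_i)| <= e for all i.  Classically this comes from separating a
    point from a convex set in a finite-dimensional space.  Over the conditional
    reals, in general neither totally ordered nor a field, the separating
    functional is written down instead of being shown to exist ([helly]).  Let
    q(x) be the sum of the squares of v_i = g_i(x) - z(g_i), and let x nearly
    minimize q on the ball.  Comparing q at x and at x + t(y - x) gives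
    -sum_i v_i g_i(y) <= -sum_i v_i g_i(x) + e^2 for every y in the ball.  The
    left side is h(y) for h = -sum_i v_i g_i, so ||h|| is at most the right side,
    and so is z(h) because ||z|| <= 1.  But z(h) = -sum_i v_i z(g_i), and the
    inequality becomes q(x) <= e^2.

    Two things are conditional rather than classical.  Near minimizers exist
    because an infimum of a stable set is nearly attained on some nonzero part of
    any given condition, and by Zorn's lemma such parts can be chosen to form a
    partition of 1 ([exhaustion]), along which the local choices glue
    ([lub_approx]).  A conditionally finite set has a length that varies with the
    condition; where the length is the natural number q it is described by q
    functionals, so [helly] applies there and the points obtained are glued
    ([helly_cfinite]).

    Density follows by localization ([closed_contains_ball]).  If z is not in a
    closed C containing the image of the ball, then on some nonzero condition a
    no part of z is in C, so z|a lies in the conditional complement of C, which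
    is open.  Helly's lemma puts some j(x)|a in this complement, but j(x)|a is
    also in C, and so a = 0. *)

(** * Partitions and stable sets *)

Section Exhaustion.
Context {d : Order.disp_t} {A : completeBoolType d}.
Implicit Types E F : condSetType A.

(** A maximal disjoint family of elements of [D] has supremum 1, since density
    would provide a further element of [D] below the complement of its supremum.
    This turns a property that holds on some part of every condition into one
    that holds along a partition, where gluing is possible. *)
Lemma exhaustion (D : set A) :
  (forall a, a <> \bot%O -> exists b, [/\ b <> \bot%O, (b <= a)%O & D b]) ->
  exists (I : Type) (a : I -> A), cpart a \top%O /\ forall i, D (a i).
Proof.
move=> dense.
pose P (X : set A) := X `<=` D /\
  forall b c, X b -> X c -> b <> c -> (b `&` c)%O = \bot%O.
have [X [[XD Xdisj] Xmax]] : exists X, P X /\ forall Y, X `<` Y -> ~ P Y.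
  apply: Zorn_bigcup => F FP Ftot; split=> [b [Y FY Yb]|].
    by have [YD _] := FP _ FY; exact: YD.
  move=> b c [Y FY Yb] [Z FZ Zc]; have [YZ|ZY] := Ftot _ _ FY FZ.
    by have [_ h] := FP _ FZ; apply: h => //; exact: YZ.
  by have [_ h] := FP _ FY; apply: h => //; exact: ZY.
exists {b | X b}, sval; split=> [|[b Xb]]; last exact: XD.
split=> [[b Xb] [c Xc] bc /=|].
  by apply: Xdisj => // e; apply: bc; exact: eq_exist.
apply: supremums_top => s hs; apply: contrapT => s1.
have [|b [b0 bs Db]] := dense (~` s)%O.
  by move=> e; apply: s1; rewrite -[s]complK e compl0.
have Xs c : X c -> (c `&` b)%O = \bot%O.
  move=> Xc; apply/eqP; rewrite -lex0 -(meetxC s).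
  by apply: leI2 => //; exact: (hs (exist _ c Xc)).
apply: (Xmax (X `|` [set b])).
  split=> [c|]; first by left.
  by move=> /(_ b (or_intror erefl)) /Xs; rewrite meetxx.
split=> [c [/XD //|->] //|c e [Xc|->] [Xe|->]] //.
- exact: Xdisj.
- by move=> _; exact: Xs.
- by move=> _; rewrite meetC; exact: Xs.
Qed.

Lemma cpart_meet (I J : Type) (a : I -> A) (b : J -> A) :
  cpart a \top%O -> cpart b \top%O ->
  cpart (fun ij : I * J => (a ij.1 `&` b ij.2)%O) \top%O.
Proof.
move=> ha hb; split=> [[i j] [k l] /= h|].
  rewrite meetACA; have [ik|ik] := pselect (i = k).
    have jl : j <> l by move=> jl; apply: h; rewrite ik jl.
    by rewrite (proj1 hb) // meetx0.
  by rewrite (proj1 ha) // meet0x.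
apply: supremums_top => s hs; apply: (cpart_le ha) => i.
have : (s `|` ~` a i)%O = \top%O.
  apply: (cpart_le hb) => j.
  rewrite -[b j]meet1x -(joinxC (a i)) meetUl leU2 // ?leIl //.
  exact: (hs (i, j)).
move=> h; rewrite -[a i]meet1x -h meetUl meetCx joinx0; exact: leIl.
Qed.

Lemma stable_set1 E (z : E) : stable_set [set z].
Proof.
split; first by exists z.
move=> I a x w ha hx hw; apply: (cond_eq ha) => i.
by rewrite hw hx.
Qed.

Lemma stable_image E F (f : E -> F) (S : set E) :
  stable_fun f -> stable_set S -> stable_set (f @` S).
Proof.
move=> hf [[x0 Sx0] hS]; split; first by exists (f x0), x0.
move=> I a y w ha hy hw.
have /choice [x hx] i : exists x, S x /\ f x = y i.
  by have [x Sx fx] := hy i; exists x.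
have [z [hz _]] := cond_glue x ha.
exists z; first by apply: hS ha _ hz => i; case: (hx i).
apply: (cond_eq ha) => i; rewrite hw; have [_ <-] := hx i.
exact: (hf I a x z ha).
Qed.

Lemma stable_on_local E F (S : set E) (f : E -> F) : stable_fun_on S f ->
  forall a x y, S x -> S y -> cond x a = cond y a ->
  cond (f x) a = cond (f y) a.
Proof.
move=> hf a x y Sx Sy h.
have hy : is_csum (bpart a) (fun b => if b then x else y) y by case.
have Sxy (b : bool) : S (if b then x else y) by case: b.
by have /(_ true) := hf _ _ _ _ (cpart_bool a) Sxy hy.
Qed.

End Exhaustion.

(** * Order and approximation in the conditional reals *)

Section Reals.
Context {d : Order.disp_t} {A : completeBoolType d} {R : crealType A}.
Implicit Types (r s x y e : R) (a b : A).

Lemma rle_onS a b x y : (b <= a)%O -> rle_on a x y -> rle_on b x y.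
Proof.
move=> ba [x' [y' [h hx hy]]].
by exists x', y'; split; [|exact: cond_mono hx|exact: cond_mono hy].
Qed.

Lemma rle_on_bot x y : rle_on \bot%O x y.
Proof. by exists x, x; split; [exact: rle_refl| |exact: cond_bot]. Qed.

Lemma radd_ge0 x y : 0 <=r x -> 0 <=r y -> 0 <=r x + y.
Proof. by move=> hx hy; rewrite -[0]addr0; exact: rle_add2. Qed.

Lemma sum_ge0 (I : finType) (F : I -> R) :
  (forall i, 0 <=r F i) -> 0 <=r \sum_i F i.
Proof.
move=> hF; apply: (big_ind (fun x => 0 <=r x)) => //; first exact: rle_refl.
exact: radd_ge0.
Qed.

(** Invertibility is the algebraic form of strict positivity: if [r] vanished on
    a nonzero condition, then so would 1 = r s. *)
Lemma clt_of_inv r s : 0 <=r r -> r * s = 1 -> clt 0 r.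
Proof.
move=> hr hrs; split=> // a a0 e; apply: (@r1_neq0 _ _ R a a0).
by rewrite -hrs -(mul0r s); apply: rmul_loc.
Qed.

Lemma clt_mul r s : clt 0 r -> clt 0 s -> clt 0 (r * s).
Proof.
move=> hr hs; have [u [u0 hu]] := clt_inv hr; have [v [v0 hv]] := clt_inv hs.
apply: (@clt_of_inv _ (u * v)).
  by apply: rmul_ge0; [case: hr|case: hs].
by rewrite mulrACA hu hv mulr1.
Qed.

Lemma clt_cancel r x : clt 0 r -> 0 <=r r * x -> 0 <=r x.
Proof.
move=> /clt_inv [s [s0 hs]] h.
by rewrite -[x]mul1r -hs [r * s]mulrC -mulrA; exact: rmul_ge0.
Qed.

Lemma cabs_sqr r : cabs r * cabs r = r * r.
Proof. by rewrite -cabsM cabs_id //; exact: rsqr_ge0. Qed.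

Lemma cabs_le_sqr r e : clt 0 e -> r * r <=r e * e -> cabs r <=r e.
Proof.
move=> he /rle_sub h; apply/rle_sub.
apply: (@clt_cancel (cabs r + e)); first exact: clt_addl (cabs_ge0 r) he.
by move: h; rewrite -(cabs_sqr r); congr (0 <=r _); ring.
Qed.

Lemma RplusplusE : Rplusplus = [set r : R | clt 0 r].
Proof.
apply: shull_id; split; first by exists 1; exact: clt01.
move=> I a x z ha hx hz; split.
  by apply: (proj2 (stable_ge 0) _ _ _ _ ha _ hz) => i; case: (hx i).
move=> b b0 e; apply: b0; apply/eqP; rewrite -lex0.
have : (~` b)%O = \top%O.
  apply: (cpart_le ha) => i; rewrite -disj_leC; apply: contraT => /eqP abi.
  have [_ /(_ _ abi) []] := hx i.
  transitivity (cond z (a i `&` b)%O); first by apply: (cond_mono _ e); exact: leIr.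
  by apply: (cond_mono _ (hz i)); exact: leIl.
by move=> h; rewrite -[b]complK h compl1.
Qed.

(** On each nonzero condition [a] some [u] in [S] comes within [e] of the
    supremum on a nonzero part of [a]: otherwise the element equal to [s - e] on
    [a] and to [s] off [a] would be a smaller upper bound. *)
Lemma lub_approx (S : set R) s e : stable_set S -> is_lub rle S s -> clt 0 e ->
  exists u, S u /\ s - e <=r u.
Proof.
move=> hS [s1 s2] [e0 e1].
have [|I [a [ha hD]]] :=
    @exhaustion _ A [set a | exists u, S u /\ rle_on a (s - e) u].
  move=> a a0; apply: contrapT => no.
  have hno u : S u -> rle_on a u (s - e).
    move=> Su; have [c [h1 h2]] := rle_dicho (s - e) u.
    apply: rle_onS h2; rewrite -disj_leC; apply: contraT => /eqP ac.
    case: no; exists (a `&` c)%O; split=> //; first exact: leIl.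
    by exists u; split=> //; apply: rle_onS h1; exact: leIr.
  have [w [w1 w2]] := glue2 a (s - e) s.
  have /s2 sw : is_ubound rle S w.
    move=> u Su; apply: (@rle_case _ _ _ a).
      by apply: rle_on_eq (hno u Su).
    by apply: rle_on_eq (rle_on_le _ (s1 u Su)).
  have [v [v1 v2]] := glue2 a e 0.
  (* s <= w says that e <= 0 on [a]; extended by 0 off [a], e is then 0 *)
  apply: (e1 a a0); rewrite -v1; congr (cond _ a); apply: rle_anti.
    apply: (@rle_case _ _ _ a).
      by apply: rle_on_eq (rle_on_le _ e0).
    by apply: rle_on_eq (rle_on_le _ (rle_refl 0)).
  apply: (@rle_case _ _ _ a).
    apply: rle_on_eq (rle_on_le _ (rle_add _ _ (e - s) sw)).
      by rewrite v1; congr (cond _ a); ring.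
    have -> : (0 : R) = (s - e) + (e - s) by ring.
    exact: radd_loc.
  by apply: rle_on_eq (rle_on_le _ (rle_refl 0)).
have [u hu] := choice hD.
have [v [hv _]] := cond_glue u ha.
exists v; split; first by apply: (proj2 hS _ _ _ _ ha _ hv) => i; case: (hu i).
apply: (rle_part ha) => i; have [_ h] := hu i.
by apply: rle_on_eq h => //; rewrite hv.
Qed.

End Reals.

(** * Helly's lemma *)

Section Normed.
Context {d : Order.disp_t} {A : completeBoolType d} {R : crealType A}.
Context {E : cnormedType R}.
Implicit Types (x y : E) (r t e : R).

Lemma dual_comb (I : finType) (f : dual E) (c : I -> R) (x : I -> E) :
  f (\sum_i c i *: x i) = \sum_i c i * f (x i).
Proof.
rewrite (big_morph f (dualD f) (dual0 f)).
by apply: eq_bigr => i _; rewrite dualZ.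
Qed.

Lemma dualN (f : dual E) x : f (- x) = - f x.
Proof. by rewrite -scaleN1r dualZ mulN1r. Qed.

Lemma cball_stable : stable_set (cball E).
Proof. by apply: shull_stable; exists 0; rewrite /= cnorm0; exact: r01. Qed.

Lemma cnormN x : cnorm (- x) = cnorm x.
Proof. by rewrite -scaleN1r cnormZ cabsN (cabs_id r01) mul1r. Qed.

Lemma cball_segment x y t : cnorm x <=r 1 -> cnorm y <=r 1 ->
  0 <=r t -> t <=r 1 -> cnorm (x + t *: (y - x)) <=r 1.
Proof.
move=> hx hy t0 /rle_sub t1.
have -> : x + t *: (y - x) = (1 - t) *: x + t *: y.
  by rewrite scalerBr scalerBl scale1r addrA addrAC.
apply: (rle_trans _ (cnormD _ _)); rewrite !cnormZ (cabs_id t0) (cabs_id t1).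
rewrite -[X in _ <=r X](subrK t) -[X in _ <=r X + _]mulr1 -[X in _ <=r _ + X]mulr1.
by apply: rle_add2; apply: rle_mul2l.
Qed.

Lemma approx_min (q : E -> R) e : stable_fun q -> (forall x, 0 <=r q x) ->
  clt 0 e ->
  exists x, cnorm x <=r 1 /\ forall y, cnorm y <=r 1 -> q x <=r q y + e.
Proof.
move=> hq q0 he.
have hS : stable_set [set - q x | x in cball E].
  apply: stable_image cball_stable; apply/stable_local => a x y xy.
  by apply: ropp_loc; have /stable_local := hq; apply.
have [|s hs] := rsup_exists hS.
  by exists 0 => _ [x _ <-]; apply/rle_sub; rewrite sub0r opprK.
have [_ [[x + <-] hx]] := lub_approx hS hs he.
rewrite cballE /= => x1; exists x; split=> // y y1.
have yB : cball E y by rewrite cballE.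
have := rle_trans _ (rle_add _ _ (- e) (proj1 hs _ (imageP _ yB))) hx.
move=> /rle_sub h; apply/rle_sub; congr (0 <=r _): h; ring.
Qed.

(** The step length of the variational argument.  With s the inverse of
    D + 1 + e, the value t = e s satisfies both bounds at once, so no case
    distinction, which the partial order would not allow, is needed. *)
Lemma small_step D e : 0 <=r D -> clt 0 e ->
  exists t, [/\ clt 0 t, t <=r 1 & t * D <=r e].
Proof.
move=> D0 he; have D1 := radd_ge0 D0 r01.
have hK : clt 0 ((D + 1) + e) by exact: clt_addl.
have [s [s0 hs]] := clt_inv hK; have [e0 _] := he.
have s1 : clt 0 s by apply: (clt_of_inv s0 (s := D + 1 + e)); rewrite mulrC.
exists (e * s); split; first exact: clt_mul.
  apply/rle_sub; rewrite (_ : _ - _ = (D + 1) * s); last by rewrite -[X in X - _]hs; ring.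
  exact: rmul_ge0.
apply/rle_sub; rewrite (_ : _ - _ = e * (s * (1 + e))).
  by apply: rmul_ge0 => //; apply: rmul_ge0 => //; exact: radd_ge0 r01 e0.
by rewrite -[X in X - _]mulr1 -[X in _ * X - _]hs; ring.
Qed.

End Normed.

Section Helly.
Context {d : Order.disp_t} {A : completeBoolType d} {R : crealType A}.
Context {E : cnormedType R}.
Implicit Types (x y : E) (r t e : R).

(** The first-order optimality condition at a near minimizer of the squared
    distance bounds the norm of [h] and thereby plays the part of the separation
    theorem. *)
Lemma helly (I : finType) (g : I -> dual E) (z : dual (dual E)) e :
  dual_norm z <=r 1 -> clt 0 e ->
  exists x, cnorm x <=r 1 /\ forall i, cabs (g i x - z (g i)) <=r e.
Proof.
move=> hz e_gt0; pose q x := \sum_i (g i x - z (g i)) * (g i x - z (g i)).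
have q_stable : stable_fun q.
  apply/stable_local => a x y xy.
  apply: (big_ind2 (fun r s => cond r a = cond s a)) => //.
    by move=> *; exact: radd_loc.
  by move=> i _; apply: rmul_loc; apply: radd_loc => //; exact: dual_loc.
have q_ge0 x : 0 <=r q x by apply: sum_ge0 => i; exact: rsqr_ge0.
(* (2 ||g_i||)^2 bounds the quadratic coefficient of q along a segment *)
pose N i := dual_norm (g i) + dual_norm (g i).
have N_ge0 i : 0 <=r N i by apply: radd_ge0; exact: dual_norm_ge.
have D_ge0 : 0 <=r \sum_i N i * N i by apply: sum_ge0 => i; exact: rmul_ge0.
have ee_gt0 := clt_mul e_gt0 e_gt0.
have [t [t_gt0 t1 tD]] := small_step D_ge0 ee_gt0.
(* the tolerance t e^2 is proportional to t so that t can be cancelled below *)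
have [x [x1 xmin]] := approx_min q_stable q_ge0 (clt_mul t_gt0 ee_gt0).
exists x; split=> //.
pose v i := g i x - z (g i).
have var y : cnorm y <=r 1 -> 0 <=r \sum_i v i * (g i y - g i x) + e * e.
  move=> y1; pose L := \sum_i v i * (g i y - g i x).
  pose Q := \sum_i (g i y - g i x) * (g i y - g i x).
  have QD : Q <=r \sum_i N i * N i.
    apply/rle_sub; rewrite -sumrB; apply: sum_ge0 => i.
    apply: (proj1 (rle_sub _ _)).
    have h : cabs (g i y - g i x) <=r N i.
      apply: (rle_trans _ (cabsD _ _)); rewrite cabsN.
      by apply: rle_add2; exact: dual_norm_ub.
    rewrite -cabs_sqr; apply: (rle_trans (cabs (g i y - g i x) * N i)).
      by apply: (rle_mul2l _ h); exact: cabs_ge0.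
    exact: rle_mul2r h.
  have qt : q (x + t *: (y - x)) = q x + t * (L + L + t * Q).
    rewrite /q /L /Q !mulrDr !mulr_sumr -!big_split /=.
    by apply: eq_bigr => i _; rewrite dualD dualZ dualD dualN /v; ring.
  have [t0 _] := t_gt0.
  have := xmin _ (cball_segment x1 y1 t0 t1); rewrite qt => /rle_sub h.
  have {}h : 0 <=r L + L + t * Q + e * e.
    by apply: (clt_cancel t_gt0); congr (0 <=r _): h; ring.
  apply: rle_double; have /rle_sub tQ := rle_trans _ (rle_mul2l t0 QD) tD.
  have := radd_ge0 h tQ; congr (0 <=r _); rewrite -/L; ring.
pose h : dual E := \sum_i (- v i) *: g i.
have hE y : h y = \sum_i (- v i) * g i y .
  exact: (dual_comb (cembed y : dual (dual E))).
have h_le y : cnorm y <=r 1 -> h y <=r h x + e * e.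
  move=> /var; move=> hy; apply/rle_sub; congr (0 <=r _): hy.
  rewrite !hE addrAC -sumrB; congr (_ + _).
  by apply: eq_bigr => i _; ring.
have h_norm : dual_norm h <=r h x + e * e.
  apply: dual_norm_le => y y1; apply: cabs_le; first exact: h_le.
  by rewrite -dualN; apply: h_le; rewrite cnormN.
have zh : z h <=r h x + e * e.
  apply: (rle_trans _ (cabs_ge _)); apply: (rle_trans _ (dual_normP z h)).
  apply: (rle_trans _ _ h_norm); rewrite -[X in _ <=r X]mul1r.
  by apply: (rle_mul2r _ hz); exact: dual_norm_ge.
have q_small : q x <=r e * e.
  move/rle_sub: zh => zh; apply/rle_sub; congr (0 <=r _): zh.
  rewrite hE dual_comb addrAC -sumrB [LHS]addrC; congr (_ + _).
  by rewrite -sumrN; apply: eq_bigr => i _; rewrite -/(v i) /v; ring.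
move=> i; apply: cabs_le_sqr => //; apply: (rle_trans _ _ q_small).
rewrite /q (bigD1 i) //=; apply/rle_sub; rewrite addrAC subrr add0r.
by rewrite big_mkcond; apply: sum_ge0 => j; case: ifP => _;
  [exact: rsqr_ge0|exact: rle_refl].
Qed.

End Helly.

(** * Conditionally finite families *)

Section ConditionallyFinite.
Context {d : Order.disp_t} {A : completeBoolType d}.

Lemma cN_intervalE (n : cN A) : cN_interval n = [set k | cN_le k n].
Proof.
have one_le (o k : cN A) : fsum_const (exist _ 1%N isT) o -> cN_le o k.
  move=> ho p q h; suff -> : p = exist _ 1%N isT by case: q {h}.
  by apply: ho => e; apply: h; rewrite e meet0x.
have -> : cN_interval n = shull [set k | cN_le k n].
  congr shull; apply/seteqP; split=> k; first by case.
  by move=> hk; split=> // o; exact: one_le.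
have [o ho] := @fsum_const_exists _ A {m | (0 < m)%N} (exist _ 1%N isT).
apply: shull_id; split; first by exists o; exact: one_le.
move=> I a k z ha hk hz p q; apply: contra_notP => pq.
rewrite -[LHS]complK -compl1; congr (~` _)%O.
apply: (cpart_le ha) => i; rewrite -disj_leC; apply/eqP.
have [/funeqP /(_ p) zk] := hz i.
rewrite meetA [(a i `&` _)%O]meetC zk meetAC.
suff -> : (k i p `&` n q)%O = \bot%O by rewrite meet0x.
by apply: contrapT => /(hk i).
Qed.

End ConditionallyFinite.

Section Goldstine.
Context {d : Order.disp_t} {A : completeBoolType d} {R : crealType A}.
Context {E : cnormedType R}.

Let pos (k : nat) : {m : nat | (0 < m)%N} := exist _ k.+1 isT.

(** Where the length n of the interval parametrizing [G] takes the value q, the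
    members of [G] are mixtures of the q functionals that correspond to
    1, ..., q.  [helly] handles these, and its points are glued along the
    partition given by n. *)
Lemma helly_cfinite (G : set (dual E)) (z : dual (dual E)) (r : R) :
  cfinite G -> dual_norm z <=r 1 -> clt 0 r ->
  exists x, cnorm x <=r 1 /\ forall g, G g -> cabs (g x - z g) <=r r.
Proof.
move=> [n [f [f_stable _ fG]]] hz hr.
have f_loc := stable_on_local f_stable.
have /choice [c hc] p : exists c : cN A, fsum_const p c.
  exact: fsum_const_exists.
(* [k (p, q)] equals p where the length is q, and 1 elsewhere, which for p <= q
   keeps it in the interval on all conditions *)
have /choice [k hk] pq : exists k : cN A,
    cond k (n pq.2) = cond (c pq.1) (n pq.2) /\
    cond k (~` n pq.2)%O = cond (c (pos 0)) (~` n pq.2)%O.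
  exact: glue2.
have k_le p q : (val p <= val q)%N -> cN_interval n (k (p, q)).
  rewrite cN_intervalE => pq p' q' h.
  have [qq|qq] := pselect (q' = q).
    rewrite qq in h *; suff -> : p' = p by [].
    apply: (hc p) => e; apply: h.
    by have [[/funeqP /(_ p') /= ->] _] := hk (p, q); rewrite e meet0x.
  have nq : (n q' <= ~` n q)%O.
    by rewrite -disj_leC; apply/eqP; apply: (proj1 (fsum_cpart n)).
  suff -> : p' = pos 0 by case: (q').
  apply: (hc (pos 0)) => e; apply: h.
  have [_ [/funeqP /(_ p') /= h1]] := hk (p, q).
  by rewrite -(meet_idPr nq) meetA h1 e !meet0x.
have /choice [x hx] q : exists x, cnorm x <=r 1 /\
    forall i : 'I_(val q), cabs (f (k (pos i, q)) x - z (f (k (pos i, q)))) <=r r.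
  exact: helly.
have [w [hw _]] := cond_glue x (fsum_cpart n).
exists w; split.
  suff : cball E w by rewrite cballE.
  apply: (proj2 cball_stable _ _ _ _ (fsum_cpart n) _ hw) => q.
  by rewrite cballE; case: (hx q).
move=> g; rewrite -fG => -[l hl <-].
apply: (rle_part (cpart_meet (fsum_cpart l) (fsum_cpart n))) => -[p q] /=.
have [pq|pq] := leqP (val p) (val q); last first.
  suff -> : (l p `&` n q)%O = \bot%O by exact: rle_on_bot.
  apply: contrapT; move: hl; rewrite cN_intervalE => hl /hl.
  by rewrite leqNgt pq.
have [_ hxq] := hx q.
have [i ip] : exists i : 'I_(val q), pos i = p.
  case: p pq => -[//|p] p0 /= pq; exists (Ordinal pq).
  by rewrite /pos; congr exist; exact: bool_irrelevance.
have := hxq i; rewrite ip => hi.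
set b := (l p `&` n q)%O.
have fl : cond (f l) b = cond (f (k (p, q))) b.
  apply: f_loc => //; first exact: k_le.
  transitivity (cond (c p) b).
    apply/fsum_condE => p1 p2 h; have -> : p2 = p.
      by apply: (hc p) => e; apply: h; rewrite e meetx0 meet0x.
    apply: contrapT => pp; apply: h.
    by rewrite /b meetACA (proj1 (fsum_cpart l)) // meet0x.
  by apply/esym/(cond_mono _ (proj1 (hk (p, q)))); exact: leIr.
apply: rle_on_eq (rle_on_le b hi) => //.
have /stable_local abs_loc := @cabs_stable _ _ R; apply: abs_loc.
apply: radd_loc.
  transitivity (cond (f (k (p, q)) w) b).
    by apply: dual_loc; apply/esym/(cond_mono _ (hw q)); exact: leIr.
  by have /funeqP /(_ w) := fl; move=> e; exact: esym e.
by apply: ropp_loc; apply: dual_loc; exact: esym fl.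
Qed.

End Goldstine.

(** * Density of the ball *)

Section Density.
Context {d : Order.disp_t} {A : completeBoolType d} {R : crealType A}.
Context {E : cnormedType R}.

Lemma cembed_ball (x : E) : cnorm x <=r 1 -> cnorm (cembed x) <=r 1.
Proof.
move=> hx; apply: dual_norm_le => f hf; apply: (rle_trans _ (dual_normP f x)).
rewrite -[X in _ <=r X]mul1r; apply: (rle_trans (1 * cnorm x)).
  by apply: rle_mul2r hf; exact: cnorm_ge.
by apply: rle_mul2l hx; exact: r01.
Qed.

Lemma sigma_nbhsP (G : set (dual E)) (r : R) (y : bidual E) : G !=set0 ->
  (forall g, G g -> cabs ((y : dual (dual E)) g) <=r r) -> sigma_nbhs G r y.
Proof.
move=> [g0 Gg0] hy; apply: sub_shull.
have hub : is_ubound rle [set cabs ((y : dual (dual E)) g) | g in G] r.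
  by move=> _ [g Gg <-]; exact: hy.
have [|_] := csup_shull _ hub; last exact.
by exists (cabs ((y : dual (dual E)) g0)), g0.
Qed.

(** The neighbourhood that openness provides is centred at a member [t] of the
    generating set of [O] that agrees with [z] on [a]; the point produced by
    Helly's lemma for [z] is moved into it. *)
Lemma open_meets_ball (O : set (obj (bidual E))) (z : bidual E) (a : A) :
  sigma_open O -> cnorm z <=r 1 -> O (cond z a) ->
  exists x, cnorm x <=r 1 /\ O (cond (cembed x) a).
Proof.
move=> [a0 [[T [_ ->]] O_open]] hz [t [b [Tt ba0 hzt]]].
have ab := cond_inj hzt; rewrite -ab {b ab} in ba0 hzt.
have [|G [r [Gst Gfin + sub]]] := O_open t; first by exists t, a0.
rewrite RplusplusE => hr.
have [x [x1 hx]] := helly_cfinite Gfin hz hr.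
exists x; split=> //.
(* [t] agrees with [z] only on [a], so the displacement is taken to be 0 off [a]
   to remain in the neighbourhood there *)
have [y [y1 y2]] := glue2 a (cembed x - z) (0 : bidual E).
have Uy : sigma_nbhs G r y.
  apply: sigma_nbhsP; first by case: Gst.
  move=> g Gg; have /stable_local abs_loc := @cabs_stable _ _ R.
  apply: (@rle_case _ _ _ a).
    apply: rle_on_eq (rle_on_le _ (hx g Gg)) => //; apply: abs_loc.
    by have /funeqP /(_ g) := y1.
  have r0 : cabs (0 : R) <=r r by rewrite cabs0; case: hr.
  apply: rle_on_eq (rle_on_le _ r0) => //; apply: abs_loc.
  by have /funeqP /(_ g) := y2.
have -> : cond (cembed x) a = cond (t + y) a.
  apply/funext => g; transitivity (cond (z g + (g x - z g)) a).
    by congr (cond _ a); ring.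
  apply: radd_loc; first by have /funeqP /(_ g) := hzt.
  by have /funeqP /(_ g) := y1.
by apply: sub; exists (t + y), a; split=> //; exists y.
Qed.

(** A condition no part of which carries [z] into [C] carries [z] into the
    complement of [C], by maximality of the complement; there
    [open_meets_ball] yields a common element of [C] and its complement.  The
    conditions on which [z] is in [C] are therefore dense, and [z] is glued back
    from its parts. *)
Lemma closed_contains_ball (C : set (obj (bidual E))) (z : bidual E) :
  sigma_closed C -> (forall x a, cnorm x <=r 1 -> C (cond (cembed x) a)) ->
  cnorm z <=r 1 -> C (cond z \top%O).
Proof.
move=> [[a0 [S [hS CE]]] [O [[csubO CO maxO] O_open]]] hC hz.
have a01 : a0 = \top%O.
  have := hC 0 \top%O; rewrite cnorm0 CE => /(_ r01) [s [b [_ ba e]]].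
  by move: ba; rewrite -(cond_inj e) le1x => /eqP.
suff Sz : S z by rewrite CE a01; exists z, \top%O.
have [|I [a [ha hD]]] := @exhaustion _ A [set a | C (cond z a)].
  move=> a an0; apply: contrapT => no; apply: an0.
  have Oz : O (cond z a).
    apply: (maxO (restr [set z] a)); last by exists z, a.
      by exists a, [set z]; split=> //; exact: stable_set1.
    apply/seteqP; split=> o.
      move=> [Co [_ [b [-> ba oE]]]]; rewrite oE in Co *.
      have -> : b = \bot%O.
        by apply: contrapT => b0; apply: no; exists b.
      by exists z, \bot%O.
    move=> [y [b [_ + ->]]]; rewrite lex0 => /eqP ->.
    have [s Ss] := proj1 hS; split.
      by rewrite CE; exists s, \bot%O; split; [|exact: le0x|exact: cond_bot].
    by exists z, \bot%O; split; [|exact: le0x|exact: cond_bot].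
  have [x [x1 Ox]] := open_meets_ball O_open hz Oz.
  have : (C `&` O) (cond (cembed x) a) by split=> //; exact: hC.
  rewrite CO => -[y [b [_ + /cond_inj ->]]].
  by rewrite lex0 => /eqP.
have /choice [s hs] i : exists s, S s /\ cond z (a i) = cond s (a i).
  have := hD i; rewrite /= CE => -[s [b [Ss _ e]]].
  by exists s; rewrite {2}(cond_inj e).
by apply: (proj2 hS _ _ s _ ha) => i; case: (hs i).
Qed.

End Density.

Theorem theorem2p4 (d : Order.disp_t) (A : completeBoolType d)
    (R : crealType A) (E : cnormedType R) (hE : csupport1 (0 : E)) :
  let jB : set (obj (bidual E)) := restr (cembed (E := E) @` cball E) \top%O in
  let B : set (obj (bidual E)) := restr (cball (bidual E)) \top%O in
  jB `<=` B /\ sigma_closure_in B jB = B.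
Proof.
move=> jB B; split.
  move=> _ [_ [a [[x + <-] a1 ->]]]; rewrite cballE => hx.
  by exists (cembed x), a; split=> //; rewrite cballE; exact: cembed_ball.
apply/seteqP; split=> [o []//|o Bo]; split=> //.
case: Bo => z [a [+ a1 ->]]; rewrite cballE => hz C hC jBC.
have Cz : C (cond z \top%O).
  apply: closed_contains_ball hC _ hz => x b hx; apply: jBC.
  by exists (cembed x), b; split; [exists x; rewrite ?cballE|exact: lex1|].
have [[a0 [S [hS CE]]] _] := hC.
move: Cz; rewrite CE => -[s [b [Ss ba /[dup] /cond_inj bE e]]].
rewrite -bE in ba e; exists s, a; split=> //; first exact: le_trans a1 ba.
exact: cond_mono a1 e.
Qed.
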